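(* Let $X$ be a finite connected simplicial complex of dimension at least $1$ and let $n\ge2$. Suppose $x$ is an interior point of a free edge of $X$, put $X_x=X\setminus\{x\}$, let $\mathbf x^0\in F_n(X_x)$, and suppose that both $F_n(X_x)$ and $F_{n-1}(X_x)$ are connected. Then there is a surjection $$\mathbb P_n(X_x,\mathbf x^0)*\mathbb F_n\twoheadrightarrow\mathbb P_n(X,\mathbf x^0)$$ from the free product of $\mathbb P_n(X_x,\mathbf x^0)$ with a free group $\mathbb F_n$ of rank $n$ onto $\mathbb P_n(X,\mathbf x^0)$. Moreover this surjection is injective on each free factor: both $\mathbb P_n(X_x,\mathbf x^0)$ and $\mathbb F_n$ embed into $\mathbb P_n(X,\mathbf x^0)$.
   Context: $F_m(Y)=\{(y_1,\dots,y_m)\in Y^m: y_a\ne y_b\text{ for }a\neq b\}$ and $\mathbb P_m(Y,\mathbf y)=\pi_1(F_m(Y),\mathbf y)$. A *free edge* of $X$ is a maximal 1-cell of $X$ not contained in the closure of any 2-cell. *)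

(* Defs.v *)
From HB Require Import structures.
From mathcomp Require Import all_boot all_order all_algebra.
From mathcomp Require Import generic_quotient.
From mathcomp Require Import all_classical reals topology normedtype homotopy.
From mathcomp Require Import ring lra.

Set Implicit Arguments.
Unset Strict Implicit.
Unset Printing Implicit Defensive.

Import Order.TTheory GRing.Theory Num.Theory.
Import numFieldNormedType.Exports.

Local Open Scope classical_set_scope.
Local Open Scope ring_scope.
Local Open Scope quotient_scope.

Definition unit_interval (R : realType) : Type := set_type `[0 : R, 1]%classic.

Section UnitInterval.
Context (R : realType).

HB.instance Definition _ := Topological.on (unit_interval R).

Definition ival (t : unit_interval R) : R := set_val t.

Fact clamp_subproof (r : R) : Num.max 0 (Num.min r 1) \in `[0 : R, 1]%classic.
Proof.
apply/mem_set; rewrite /= in_itv /= le_max lexx /= ge_max ler01 /=.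
by rewrite ge_min lexx orbT.
Qed.

Definition clamp (r : R) : unit_interval R :=
  exist (fun x => x \in `[0 : R, 1]%classic) _ (clamp_subproof r).

Lemma ival_clamp r : ival (clamp r) = Num.max 0 (Num.min r 1).
Proof. by rewrite /ival set_valE. Qed.

Lemma ival_ge0 t : 0 <= ival t.
Proof.
by rewrite /ival set_valE; case: t => t /= /set_mem /=; rewrite in_itv => /andP[].
Qed.

Lemma ival_le1 t : ival t <= 1.
Proof.
by rewrite /ival set_valE; case: t => t /= /set_mem /=; rewrite in_itv => /andP[].
Qed.

Lemma ival_inj : injective ival.
Proof. by move=> s t; rewrite /ival !set_valE => /val_inj. Qed.

Lemma clamp_id r : 0 <= r -> r <= 1 -> ival (clamp r) = r.
Proof. by move=> r0 r1; rewrite ival_clamp (min_idPl r1) (max_idPr r0). Qed.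

Lemma ivalK : cancel ival clamp.
Proof. by move=> t; apply: ival_inj; rewrite clamp_id ?ival_ge0 ?ival_le1. Qed.

Fact clamp01 : clamp 0 != clamp 1.
Proof.
apply/eqP => /(congr1 ival); rewrite !clamp_id ?ler01 ?lexx //.
by move/eqP; rewrite eq_sym oner_eq0.
Qed.

HB.instance Definition _ :=
  isBiPointed.Build (unit_interval R) clamp01.

Lemma ival0 : ival zero = 0.
Proof. by rewrite clamp_id ?ler01 ?lexx. Qed.

Lemma ival1 : ival classical_sets.one = 1.
Proof. by rewrite clamp_id ?ler01 ?lexx. Qed.

Lemma clamp_le0 r : r <= 0 -> clamp r = zero.
Proof.
move=> r0; apply: ival_inj; rewrite ival0 ival_clamp.
by rewrite (min_idPl (le_trans r0 ler01)) (max_idPl r0).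
Qed.

Lemma clamp_ge1 r : 1 <= r -> clamp r = classical_sets.one.
Proof.
move=> r1; apply: ival_inj; rewrite ival1 ival_clamp.
by rewrite (min_idPr r1) (max_idPr ler01).
Qed.

Lemma ival_continuous : continuous ival.
Proof. exact: initial_continuous. Qed.

Lemma clamp_continuous : continuous clamp.
Proof.
apply: continuous_comp_initial => r.
rewrite (_ : _ \o _ = fun r : R => Num.max 0 (Num.min r 1)); last first.
  by apply/funext => u /=; rewrite set_valE.
apply: (@continuous_max R R (fun=> 0) (fun r => Num.min r 1)).
  exact: cvg_cst.
apply: (@continuous_min R R id (fun=> 1)); [exact: cvg_id|exact: cvg_cst].
Qed.

End UnitInterval.
Arguments clamp {R}.

Lemma paste_continuous (R : realType) (S T : topologicalType) (c : S -> R)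
    (u v : S -> T) :
  continuous c -> continuous u -> continuous v ->
  (forall s, c s = 0 -> u s = v s) ->
  continuous (fun s => if c s <= 0 then u s else v s).
Proof.
move=> cc cu cv uv; set h := fun s => _.
have cA : closed [set s | c s <= 0].
  by apply: (closed_comp (f := c) (D := [set r | r <= 0])) => //; exact: closed_le.
have cB : closed [set s | 0 <= c s].
  by apply: (closed_comp (f := c) (D := [set r | 0 <= r])) => //; exact: closed_ge.
have AB : [set s | c s <= 0] `|` [set s | 0 <= c s] = setT.
  by apply/seteqP; split => // s _; case: (leP (c s) 0) => [|/ltW]; [left|right].
apply/continuous_subspace_setT; rewrite -AB; apply: withinU_continuous => //.
  apply: (@subspace_eq_continuous _ _ _ u); last exact: continuous_subspaceT.
  by move=> s /set_mem cs; rewrite /from_subspace /h ifT.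
apply: (@subspace_eq_continuous _ _ _ v); last exact: continuous_subspaceT.
move=> s /set_mem cs; rewrite /from_subspace /h; case: ifPn => // cs'.
by rewrite uv //; apply/eqP; rewrite eq_le cs' cs.
Qed.

Section Homotopy.
Context (R : realType) (T : topologicalType).
Local Notation I := (unit_interval R).
Implicit Types x y z : T.

Definition homotopic x y (f g : {path I from x to y}) : Prop :=
  exists H : I * I -> T,
    [/\ continuous H, forall s, H (s, zero) = f s,
        forall s, H (s, classical_sets.one) = g s &
        forall t, H (zero, t) = x /\ H (classical_sets.one, t) = y].

Lemma ival_fst_continuous : continuous (fun p : I * I => ival p.1).
Proof.
by move=> p; apply: continuous_comp; [exact: cvg_fst|exact: ival_continuous].
Qed.

Lemma ival_snd_continuous : continuous (fun p : I * I => ival p.2).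
Proof.
by move=> p; apply: continuous_comp; [exact: cvg_snd|exact: ival_continuous].
Qed.

Lemma clamp_comp_continuous (S : topologicalType) (c : S -> R) :
  continuous c -> continuous (clamp \o c).
Proof.
by move=> cc s; apply: continuous_comp; [exact: cc|exact: clamp_continuous].
Qed.

Lemma pair_comp_continuous (S : topologicalType) (H : I * I -> T)
    (a b : S -> R) : continuous H -> continuous a -> continuous b ->
  continuous (fun s => H (clamp (a s), clamp (b s))).
Proof.
move=> cH ca cb s.
apply: (@continuous_comp _ _ _ (fun s => (clamp (a s), clamp (b s))) H);
  last exact: cH.
exact: (cvg_pair (clamp_comp_continuous ca (x := s))
                 (clamp_comp_continuous cb (x := s))).
Qed.

Lemma path_comp_continuous (S : topologicalType) x y (f : {path I from x to y})
    (a : S -> R) : continuous a -> continuous (fun s => f (clamp (a s))).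
Proof.
move=> ca s; apply: (@continuous_comp _ _ _ (clamp \o a) f).
  exact: clamp_comp_continuous.
exact: cts_fun.
Qed.

Lemma affine_continuous (S : topologicalType) (a : S -> R) (k l : R) :
  continuous a -> continuous (fun s => k * a s + l).
Proof.
move=> ca s; apply: cvgD; last exact: cvg_cst.
by apply: cvgM; [exact: cvg_cst|exact: ca].
Qed.

Lemma homotopic_refl x y (f : {path I from x to y}) : homotopic f f.
Proof.
exists (f \o fst); split => //= [|t]; last by rewrite path_zero path_one.
by move=> p; apply: continuous_comp; [exact: cvg_fst|exact: cts_fun].
Qed.

Lemma homotopic_sym x y (f g : {path I from x to y}) :
  homotopic f g -> homotopic g f.
Proof.
case=> H [cH H0 H1 Hxy].
exists (fun p => H (clamp (1 * ival p.1 + 0), clamp (-1 * ival p.2 + 1))); split.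
- apply: pair_comp_continuous => //; apply: affine_continuous.
    exact: ival_fst_continuous.
  exact: ival_snd_continuous.
- by move=> s /=; rewrite mul1r addr0 ivalK ival0 mulr0 add0r H1.
- by move=> s /=; rewrite mul1r addr0 ivalK ival1 mulr1 addNr H0.
- by move=> t /=; rewrite !mul1r !addr0 !ivalK; exact: Hxy.
Qed.

Lemma homotopic_trans x y (f g h : {path I from x to y}) :
  homotopic f g -> homotopic g h -> homotopic f h.
Proof.
case=> H [cH H0 H1 Hxy] [K [cK K0 K1 Kxy]].
pose u (p : I * I) := H (clamp (1 * ival p.1 + 0), clamp (2 * ival p.2 + 0)).
pose v (p : I * I) := K (clamp (1 * ival p.1 + 0), clamp (2 * ival p.2 + -1)).
exists (fun p => if 2 * ival p.2 + -1 <= 0 then u p else v p); split.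
- apply: paste_continuous.
  + by apply: affine_continuous; exact: ival_snd_continuous.
  + apply: pair_comp_continuous => //; apply: affine_continuous.
      exact: ival_fst_continuous.
    exact: ival_snd_continuous.
  + apply: pair_comp_continuous => //; apply: affine_continuous.
      exact: ival_fst_continuous.
    exact: ival_snd_continuous.
  + move=> p p0; rewrite /u /v p0 mul1r addr0 ivalK.
    rewrite (_ : 2 * ival p.2 + 0 = 1); last by lra.
    by rewrite H1 K0.
- move=> s /=; rewrite ival0 ifT; last by lra.
  by rewrite /u /= mul1r addr0 ivalK ival0 mulr0 addr0 H0.
- move=> s /=; rewrite ival1 ifF; last by apply/negbTE; rewrite -ltNge; lra.
  rewrite /v /= mul1r addr0 ivalK ival1 (_ : 2 * 1 + -1 = 1) ?K1 //; lra.
- move=> t; rewrite /u /v /= !mul1r !addr0 !ivalK.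
  by case: ifP => _; [exact: Hxy|exact: Kxy].
Qed.

Lemma homotopic_reparam x y a b (f : {path I from a to b})
    (p q : {path I from x to y}) (phi psi : I -> R) :
  continuous phi -> continuous psi ->
  phi zero = psi zero -> phi classical_sets.one = psi classical_sets.one ->
  (forall t, p t = f (clamp (phi t))) -> (forall t, q t = f (clamp (psi t))) ->
  homotopic p q.
Proof.
move=> cphi cpsi e0 e1 pE qE.
exists (fun s => f (clamp (phi s.1 + ival s.2 * (psi s.1 - phi s.1)))); split.
- apply: path_comp_continuous => s.
  have c1 : {for s, continuous (fun s : I * I => phi s.1)}.
    by apply: (@continuous_comp _ _ _ fst phi); [exact: cvg_fst|exact: cphi].
  have c2 : {for s, continuous (fun s : I * I => psi s.1)}.
    by apply: (@continuous_comp _ _ _ fst psi); [exact: cvg_fst|exact: cpsi].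
  apply: cvgD => //; apply: cvgM; first exact: ival_snd_continuous.
  exact: cvgB.
- by move=> s /=; rewrite ival0 mul0r addr0 pE.
- by move=> s /=; rewrite ival1 mul1r addrC subrK qE.
- move=> t /=; rewrite e0 e1 !subrr !mulr0 !addr0 -e0 -e1 -!pE.
  by rewrite path_zero path_one.
Qed.

Section Concat.
Context (x y z : T) (f : {path I from x to y}) (g : {path I from y to z}).

Definition concat_fun (t : I) : T :=
  if ival t <= 2^-1 then f (clamp (2 * ival t)) else g (clamp (2 * ival t - 1)).

Lemma concat_funE t : concat_fun t =
  if 2 * ival t + -1 <= 0 then f (clamp (2 * ival t + 0))
  else g (clamp (2 * ival t + -1)).
Proof.
rewrite /concat_fun addr0; congr (if _ then _ else _).
by apply/idP/idP => h; lra.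
Qed.

Fact concat_continuous : continuous concat_fun.
Proof.
rewrite (funext concat_funE); apply: paste_continuous.
- by apply: affine_continuous; exact: ival_continuous.
- by apply: path_comp_continuous; apply: affine_continuous; exact: ival_continuous.
- by apply: path_comp_continuous; apply: affine_continuous; exact: ival_continuous.
- move=> t t0; rewrite t0 (@clamp_le0 _ 0) // path_zero.
  by rewrite clamp_ge1 ?path_one //; lra.
Qed.

Fact concat_zero : concat_fun zero = x.
Proof.
rewrite concat_funE ival0 ifT; last by lra.
by rewrite clamp_le0 ?path_zero //; lra.
Qed.

Fact concat_one : concat_fun classical_sets.one = z.
Proof.
rewrite concat_funE ival1 ifF; last by apply/negbTE; rewrite -ltNge; lra.
by rewrite clamp_ge1 ?path_one //; lra.
Qed.

Definition concat : {path I from x to z} :=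
  mk_path concat_continuous concat_zero concat_one.

Lemma concatE t : concat t =
  if 2 * ival t + -1 <= 0 then f (clamp (2 * ival t + 0))
  else g (clamp (2 * ival t + -1)).
Proof. exact: concat_funE. Qed.

End Concat.

Section Reverse.
Context (x y : T) (f : {path I from x to y}).

Definition reverse_fun (t : I) : T := f (clamp (1 - ival t)).

Lemma reverse_funE t : reverse_fun t = f (clamp (-1 * ival t + 1)).
Proof. by rewrite /reverse_fun mulN1r addrC. Qed.

Fact reverse_continuous : continuous reverse_fun.
Proof.
rewrite (funext reverse_funE).
by apply: path_comp_continuous; apply: affine_continuous; exact: ival_continuous.
Qed.

Fact reverse_zero : reverse_fun zero = y.
Proof. by rewrite reverse_funE ival0 clamp_ge1 ?path_one //; lra. Qed.

Fact reverse_one : reverse_fun classical_sets.one = x.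
Proof. by rewrite reverse_funE ival1 clamp_le0 ?path_zero //; lra. Qed.

Definition reverse : {path I from y to x} :=
  mk_path reverse_continuous reverse_zero reverse_one.

Lemma reverseE t : reverse t = f (clamp (-1 * ival t + 1)).
Proof. exact: reverse_funE. Qed.

End Reverse.

Definition const_path x : {path I from x to x} := cst x.

Lemma homotopic_concat x y z (f f' : {path I from x to y})
    (g g' : {path I from y to z}) :
  homotopic f f' -> homotopic g g' -> homotopic (concat f g) (concat f' g').
Proof.
case=> H [cH H0 H1 Hxy] [K [cK K0 K1 Kyz]].
pose u (p : I * I) := H (clamp (2 * ival p.1 + 0), clamp (1 * ival p.2 + 0)).
pose v (p : I * I) := K (clamp (2 * ival p.1 + -1), clamp (1 * ival p.2 + 0)).
exists (fun p => if 2 * ival p.1 + -1 <= 0 then u p else v p); split.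
- apply: paste_continuous.
  + by apply: affine_continuous; exact: ival_fst_continuous.
  + apply: pair_comp_continuous => //; apply: affine_continuous.
      exact: ival_fst_continuous.
    exact: ival_snd_continuous.
  + apply: pair_comp_continuous => //; apply: affine_continuous.
      exact: ival_fst_continuous.
    exact: ival_snd_continuous.
  + move=> p p0; rewrite /u /v p0 mul1r !addr0 ivalK.
    rewrite (_ : 2 * ival p.1 = 1); last by lra.
    by rewrite (Hxy _).2 (Kyz _).1.
- by move=> s; rewrite concatE /u /v /= mul1r !addr0 ivalK H0 K0.
- by move=> s; rewrite concatE /u /v /= mul1r !addr0 ivalK H1 K1.
- move=> t; rewrite /u /v /= ival0 ival1 mul1r !addr0 ivalK; split.
    rewrite ifT; last by lra.
    by rewrite clamp_le0 ?(Hxy _).1 //; lra.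
  rewrite ifF; last by apply/negbTE; rewrite -ltNge; lra.
  by rewrite clamp_ge1 ?(Kyz _).2 //; lra.
Qed.

Lemma homotopic_reverse x y (f f' : {path I from x to y}) :
  homotopic f f' -> homotopic (reverse f) (reverse f').
Proof.
case=> H [cH H0 H1 Hxy].
exists (fun p => H (clamp (-1 * ival p.1 + 1), clamp (1 * ival p.2 + 0))); split.
- apply: pair_comp_continuous => //; apply: affine_continuous.
    exact: ival_fst_continuous.
  exact: ival_snd_continuous.
- by move=> s /=; rewrite reverseE mul1r addr0 ivalK H0.
- by move=> s /=; rewrite reverseE mul1r addr0 ivalK H1.
- move=> t /=; rewrite ival0 ival1 mul1r addr0 ivalK.
  by rewrite clamp_ge1 ?clamp_le0 ?(Hxy _).1 ?(Hxy _).2 //; lra.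
Qed.

Fact assoc_phiE (r : R) :
  let phi := Num.min (2 * r + 0)
    (Num.min (1 * r + 4^-1) (2^-1 * r + 2^-1)) in
  [/\ 4 * r <= 1 -> phi = 2 * r + 0,
      1 <= 4 * r -> 2 * r <= 1 -> phi = 1 * r + 4^-1 &
      1 <= 2 * r -> phi = 2^-1 * r + 2^-1].
Proof.
split=> [r4|r4 r2|r2].
- by rewrite (min_idPl (x := 1 * r + _) _) ?min_l //; lra.
- by rewrite (min_idPl (x := 1 * r + _) _) ?min_r //; lra.
- by rewrite (min_idPr (x := 1 * r + _) _) ?min_r //; lra.
Qed.

Lemma homotopic_concatA x y z w (f : {path I from x to y})
    (g : {path I from y to z}) (h : {path I from z to w}) :
  homotopic (concat f (concat g h)) (concat (concat f g) h).
Proof.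
pose phi (t : I) : R := Num.min (2 * ival t + 0)
  (Num.min (1 * ival t + 4^-1) (2^-1 * ival t + 2^-1)).
have phiE t : [/\ 4 * ival t <= 1 -> phi t = 2 * ival t + 0,
    1 <= 4 * ival t -> 2 * ival t <= 1 -> phi t = 1 * ival t + 4^-1 &
    1 <= 2 * ival t -> phi t = 2^-1 * ival t + 2^-1] := assoc_phiE (ival t).
have cphi : continuous phi.
  have ca k l : continuous (fun t : I => k * ival t + l).
    by apply: affine_continuous; exact: ival_continuous.
  move=> t; apply: (@continuous_min R I); first exact: ca.
  by apply: (@continuous_min R I); exact: ca.
apply: (@homotopic_reparam _ _ _ _ (concat f (concat g h)) _ _ (@ival R) phi).
- exact: ival_continuous.
- exact: cphi.
- by have [phi1 _ _] := phiE zero; rewrite phi1 ival0; lra.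
- by have [_ _ phi3] := phiE classical_sets.one; rewrite phi3 ival1; lra.
- by move=> t; rewrite ivalK.
move=> t; rewrite !concatE.
have t0 := ival_ge0 t; have t1 := ival_le1 t.
have [phi1 phi2 phi3] := phiE t.
have [t2|t2] := leP (2 * ival t + -1) 0.
  rewrite [ival (clamp (2 * _ + 0))]clamp_id; [|lra|lra].
  have [t4|t4] := leP (2 * (2 * ival t + 0) + -1) 0.
    rewrite phi1; last by lra.
    rewrite clamp_id; [|lra|lra].
    by rewrite ifT; [congr (f (clamp _)); lra|lra].
  rewrite phi2; [|lra|lra].
  rewrite [ival (clamp (1 * _ + _))]clamp_id; [|lra|lra].
  rewrite ifF; last by apply/negbTE; rewrite -ltNge; lra.
  rewrite clamp_id; [|lra|lra].
  rewrite ifT; last by lra.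
  by congr (g (clamp _)); lra.
rewrite phi3; last by lra.
rewrite [ival (clamp (2^-1 * _ + _))]clamp_id; [|lra|lra].
rewrite ifF; last by apply/negbTE; rewrite -ltNge; lra.
rewrite clamp_id; [|lra|lra].
rewrite ifF; last by apply/negbTE; rewrite -ltNge; lra.
by congr (h (clamp _)); lra.
Qed.

Lemma homotopic_const_concat x y (f : {path I from x to y}) :
  homotopic (concat (const_path x) f) f.
Proof.
apply: (@homotopic_reparam _ _ _ _ f _ _
  (fun t => Num.max 0 (2 * ival t + -1)) (@ival R)).
- move=> t; apply: (@continuous_max R I (fun=> 0)); first exact: (@cst_continuous I R 0).
  by apply: affine_continuous; exact: ival_continuous.
- exact: ival_continuous.
- by rewrite ival0; case: (leP _ _) => /=; lra.
- by rewrite ival1; case: (leP _ _) => /=; lra.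
- move=> t; rewrite !concatE.
  case: (leP (2 * ival t + -1) 0) => // _.
  by rewrite (@clamp_le0 _ 0) // path_zero.
- by move=> t; rewrite ivalK.
Qed.

Lemma homotopic_concat_const x y (f : {path I from x to y}) :
  homotopic (concat f (const_path y)) f.
Proof.
apply: (@homotopic_reparam _ _ _ _ f _ _
  (fun t => Num.min 1 (2 * ival t + 0)) (@ival R)).
- move=> t; apply: (@continuous_min R I (fun=> 1)); first exact: (@cst_continuous I R 1).
  by apply: affine_continuous; exact: ival_continuous.
- exact: ival_continuous.
- by rewrite ival0; case: (leP _ _) => /=; lra.
- by rewrite ival1; case: (leP _ _) => /=; lra.
- move=> t; rewrite !concatE.
  case: (leP (2 * ival t + -1) 0) => t2; case: (leP 1 _) => t3 //.
  + by congr (f (clamp _)); lra.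
  + by rewrite (@clamp_ge1 _ 1) // path_one.
  + by exfalso; lra.
- by move=> t; rewrite ivalK.
Qed.

Lemma homotopic_concat_reverse x y (f : {path I from x to y}) :
  homotopic (concat f (reverse f)) (const_path x).
Proof.
apply: (@homotopic_reparam _ _ _ _ f _ _
  (fun t => Num.min (2 * ival t + 0) (-2 * ival t + 2)) (fun=> 0)).
- by move=> t; apply: (@continuous_min R I);
    apply: affine_continuous; exact: ival_continuous.
- exact: cst_continuous.
- by rewrite ival0; case: (leP _ _) => /=; lra.
- by rewrite ival1; case: (leP _ _) => /=; lra.
- move=> t; have t0 := ival_ge0 t; have t1 := ival_le1 t.
  rewrite concatE reverseE.
  case: (leP (2 * ival t + -1) 0) => t2.
    by congr (f (clamp _)); case: (leP _ _) => /=; lra.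
  rewrite clamp_id; [|lra|lra].
  by congr (f (clamp _)); case: (leP _ _) => /=; lra.
- by move=> t; rewrite clamp_le0 ?path_zero.
Qed.

Lemma homotopic_reverse_concat x y (f : {path I from x to y}) :
  homotopic (concat (reverse f) f) (const_path y).
Proof.
apply: (@homotopic_reparam _ _ _ _ f _ _
  (fun t => Num.max (-2 * ival t + 1) (2 * ival t + -1)) (fun=> 1)).
- by move=> t; apply: (@continuous_max R I);
    apply: affine_continuous; exact: ival_continuous.
- exact: cst_continuous.
- by rewrite ival0; case: (leP _ _) => /=; lra.
- by rewrite ival1; case: (leP _ _) => /=; lra.
- move=> t; have t0 := ival_ge0 t; have t1 := ival_le1 t.
  rewrite concatE reverseE.
  case: (leP (2 * ival t + -1) 0) => t2.
    rewrite clamp_id; [|lra|lra].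
    by congr (f (clamp _)); case: (leP _ _) => /=; lra.
  by congr (f (clamp _)); case: (leP _ _) => /=; lra.
- by move=> t; rewrite clamp_ge1 ?path_one.
Qed.

End Homotopy.

Section FundamentalGroup.
Context (R : realType) (T : topologicalType) (x : T).
Local Notation I := (unit_interval R).
Local Notation loop := {path I from x to x}.

Definition homotopicb (f g : loop) : bool := `[< homotopic f g >].

Fact homotopicb_refl : reflexive homotopicb.
Proof. by move=> f; apply/asboolP; exact: homotopic_refl. Qed.

Fact homotopicb_sym : symmetric homotopicb.
Proof. by move=> f g; apply/asboolP/asboolP; exact: homotopic_sym. Qed.

Fact homotopicb_trans : transitive homotopicb.
Proof.
move=> g f h /asboolP fg /asboolP gh; apply/asboolP.
exact: homotopic_trans fg gh.
Qed.

Definition homotopic_equiv :=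
  EquivRel homotopicb homotopicb_refl homotopicb_sym homotopicb_trans.

Definition pi1 : Type := {eq_quot homotopic_equiv}.

HB.instance Definition _ := Choice.on pi1.
HB.instance Definition _ := Quotient.on pi1.

Definition pi1_class (f : loop) : pi1 := \pi_pi1 f.

Lemma pi1_classP f g : pi1_class f = pi1_class g <-> homotopic f g.
Proof. by split => [/eqmodP/asboolP|fg]; last exact/eqmodP/asboolP. Qed.

Lemma pi1_classK (a : pi1) : pi1_class (repr a) = a.
Proof. exact: reprK. Qed.

Lemma repr_pi1_class f : homotopic (repr (pi1_class f)) f.
Proof. by apply/pi1_classP; exact: pi1_classK. Qed.

Definition pi1_one : pi1 := pi1_class (const_path R x).
Definition pi1_mul (a b : pi1) : pi1 := pi1_class (concat (repr a) (repr b)).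
Definition pi1_inv (a : pi1) : pi1 := pi1_class (reverse (repr a)).

Lemma pi1_mulE f g :
  pi1_mul (pi1_class f) (pi1_class g) = pi1_class (concat f g).
Proof. by apply/pi1_classP; apply: homotopic_concat; exact: repr_pi1_class. Qed.

Lemma pi1_invE f : pi1_inv (pi1_class f) = pi1_class (reverse f).
Proof. by apply/pi1_classP; apply: homotopic_reverse; exact: repr_pi1_class. Qed.

Fact pi1_mulA : associative pi1_mul.
Proof.
move=> a b c; rewrite -[a]pi1_classK -[b]pi1_classK -[c]pi1_classK !pi1_mulE.
by apply/pi1_classP; exact: homotopic_concatA.
Qed.

Fact pi1_mul1g : left_id pi1_one pi1_mul.
Proof.
move=> a; rewrite -[a]pi1_classK pi1_mulE.
by apply/pi1_classP; exact: homotopic_const_concat.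
Qed.

Fact pi1_mulg1 : right_id pi1_one pi1_mul.
Proof.
move=> a; rewrite -[a]pi1_classK pi1_mulE.
by apply/pi1_classP; exact: homotopic_concat_const.
Qed.

Fact pi1_mulVg : left_inverse pi1_one pi1_inv pi1_mul.
Proof.
move=> a; rewrite -[a]pi1_classK pi1_invE pi1_mulE.
by apply/pi1_classP; exact: homotopic_reverse_concat.
Qed.

Fact pi1_mulgV : right_inverse pi1_one pi1_inv pi1_mul.
Proof.
move=> a; rewrite -[a]pi1_classK pi1_invE pi1_mulE.
by apply/pi1_classP; exact: homotopic_concat_reverse.
Qed.

HB.instance Definition _ :=
  isGroup.Build pi1 pi1_mulA pi1_mul1g pi1_mulg1 pi1_mulVg pi1_mulgV.

End FundamentalGroup.

Section Presentation.
Context (S : choiceType).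

(* The letter (s, true) stands for s and (s, false) for its inverse. *)
Definition word := seq (S * bool).

Definition word_inv (w : word) : word := rev [seq (l.1, ~~ l.2) | l <- w].

Context (rel : word -> word -> Prop).

(* The smallest congruence on words that contains rel and cancels a letter
   against its inverse. *)
Inductive pres_eq : word -> word -> Prop :=
| pres_refl u : pres_eq u u
| pres_sym u v : pres_eq u v -> pres_eq v u
| pres_trans u v w : pres_eq u v -> pres_eq v w -> pres_eq u w
| pres_cat u u' v v' :
    pres_eq u u' -> pres_eq v v' -> pres_eq (u ++ v) (u' ++ v')
| pres_cancel s b : pres_eq [:: (s, b); (s, ~~ b)] [::]
| pres_rel u v : rel u v -> pres_eq u v.

Lemma pres_inv_cat w : pres_eq (word_inv w ++ w) [::].
Proof.
elim: w => [|[s b] w IHw]; first exact: pres_refl.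
rewrite /word_inv /= rev_cons cat_rcons
  -[_ :: _ :: w]/([:: (s, ~~ b); (s, b)] ++ w).
apply: pres_trans IHw; apply: pres_cat; first exact: pres_refl.
rewrite -[X in pres_eq _ X]cat0s; apply: pres_cat; last exact: pres_refl.
by have := pres_cancel s (~~ b); rewrite negbK.
Qed.

Lemma pres_cat_inv w : pres_eq (w ++ word_inv w) [::].
Proof.
have -> : pres_eq (w ++ word_inv w) =
    pres_eq (word_inv (word_inv w) ++ word_inv w).
  congr (pres_eq (_ ++ _)); rewrite [in RHS]/word_inv map_rev revK -map_comp.
  by rewrite -[LHS]map_id; apply: eq_map => -[s b] /=; rewrite negbK.
exact: pres_inv_cat.
Qed.

Lemma pres_inv u v : pres_eq u v -> pres_eq (word_inv u) (word_inv v).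
Proof.
move=> uv; rewrite -[word_inv u]cats0.
apply: (@pres_trans _ (word_inv u ++ (v ++ word_inv v))).
  by apply: pres_cat; [exact: pres_refl|exact/pres_sym/pres_cat_inv].
rewrite catA -[X in pres_eq _ X]cat0s; apply: pres_cat; last exact: pres_refl.
apply: (@pres_trans _ (word_inv u ++ u)); last exact: pres_inv_cat.
by apply: pres_cat; [exact: pres_refl|exact: pres_sym].
Qed.

Definition pres_eqb (u v : word) : bool := `[< pres_eq u v >].

Fact pres_eqb_refl : reflexive pres_eqb.
Proof. by move=> u; apply/asboolP; exact: pres_refl. Qed.

Fact pres_eqb_sym : symmetric pres_eqb.
Proof. by move=> u v; apply/asboolP/asboolP; exact: pres_sym. Qed.

Fact pres_eqb_trans : transitive pres_eqb.
Proof.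
by move=> v u w /asboolP uv /asboolP vw; apply/asboolP; exact: pres_trans uv vw.
Qed.

Definition pres_equiv :=
  EquivRel pres_eqb pres_eqb_refl pres_eqb_sym pres_eqb_trans.

Definition pres_group : Type := {eq_quot pres_equiv}.

HB.instance Definition _ := Choice.on pres_group.
HB.instance Definition _ := Quotient.on pres_group.

Definition pres_class (w : word) : pres_group := \pi_pres_group w.

Lemma pres_classP u v : pres_class u = pres_class v <-> pres_eq u v.
Proof. by split => [/eqmodP/asboolP|uv]; last exact/eqmodP/asboolP. Qed.

Lemma pres_classK (a : pres_group) : pres_class (repr a) = a.
Proof. exact: reprK. Qed.

Lemma repr_pres_class u : pres_eq (repr (pres_class u)) u.
Proof. by apply/pres_classP; exact: pres_classK. Qed.

Definition pres_one : pres_group := pres_class [::].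
Definition pres_mul (a b : pres_group) : pres_group :=
  pres_class (repr a ++ repr b).
Definition pres_invg (a : pres_group) : pres_group :=
  pres_class (word_inv (repr a)).

Lemma pres_mulE u v : pres_mul (pres_class u) (pres_class v) = pres_class (u ++ v).
Proof. by apply/pres_classP; apply: pres_cat; exact: repr_pres_class. Qed.

Lemma pres_invE u : pres_invg (pres_class u) = pres_class (word_inv u).
Proof. by apply/pres_classP; apply: pres_inv; exact: repr_pres_class. Qed.

Fact pres_mulA : associative pres_mul.
Proof.
move=> a b c; rewrite -[a]pres_classK -[b]pres_classK -[c]pres_classK.
by rewrite !pres_mulE catA.
Qed.

Fact pres_mul1g : left_id pres_one pres_mul.
Proof. by move=> a; rewrite -[a]pres_classK pres_mulE. Qed.

Fact pres_mulg1 : right_id pres_one pres_mul.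
Proof. by move=> a; rewrite -[a]pres_classK pres_mulE cats0. Qed.

Fact pres_mulVg : left_inverse pres_one pres_invg pres_mul.
Proof.
move=> a; rewrite -[a]pres_classK pres_invE pres_mulE.
by apply/pres_classP; exact: pres_inv_cat.
Qed.

Fact pres_mulgV : right_inverse pres_one pres_invg pres_mul.
Proof.
move=> a; rewrite -[a]pres_classK pres_invE pres_mulE.
by apply/pres_classP; exact: pres_cat_inv.
Qed.

HB.instance Definition _ :=
  isGroup.Build pres_group pres_mulA pres_mul1g pres_mulg1 pres_mulVg pres_mulgV.

End Presentation.

Definition free_group (n : nat) : groupType :=
  pres_group (fun _ _ : word 'I_n => False).

Section FreeProduct.
Context (G H : groupType).

(* The multiplication tables of the factors; the relations for units and
   inverses follow from these. *)
Inductive free_product_rel : word (G + H)%type -> word (G + H)%type -> Prop :=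
| free_product_rel_inl (a b : G) : free_product_rel
    [:: (inl a, true); (inl b, true)] [:: (inl (a * b)%g, true)]
| free_product_rel_inr (a b : H) : free_product_rel
    [:: (inr a, true); (inr b, true)] [:: (inr (a * b)%g, true)].

Definition free_product : groupType := pres_group free_product_rel.

Definition free_product_inl (a : G) : free_product :=
  pres_class free_product_rel [:: (inl a, true)].

Definition free_product_inr (b : H) : free_product :=
  pres_class free_product_rel [:: (inr b, true)].

Fact free_product_inlM : {morph free_product_inl : a b / (a * b)%g}.
Proof.
move=> a b; rewrite [RHS]pres_mulE; apply/pres_classP/pres_sym/pres_rel.
exact: free_product_rel_inl.
Qed.

Fact free_product_inrM : {morph free_product_inr : a b / (a * b)%g}.
Proof.
move=> a b; rewrite [RHS]pres_mulE; apply/pres_classP/pres_sym/pres_rel.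
exact: free_product_rel_inr.
Qed.

HB.instance Definition _ :=
  isMultiplicative.Build G free_product free_product_inl free_product_inlM.
HB.instance Definition _ :=
  isMultiplicative.Build H free_product free_product_inr free_product_inrM.

End FreeProduct.
Arguments free_product_inl {G H}.
Arguments free_product_inr {G H}.

Definition conf (T : topologicalType) (m : nat) (Y : set T) :
    set {ptws 'I_m -> T} :=
  [set y | (forall a, Y (y a)) /\ (forall a b, a <> b -> y a <> y b)].
Arguments conf {T} m Y.

Definition pure_braid_group (R : realType) (T : topologicalType) (m : nat)
  (Y : set T) (y : conf m Y) : groupType := pi1 R y.

Section ConfInclusion.
Context (T : topologicalType) (m : nat) (Y Z : set T) (YZ : Y `<=` Z).

Fact conf_incl_subproof (y : conf m Y) : set_val y \in conf m Z.
Proof.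
rewrite set_valE; case: y => y /= /set_mem [Yy yinj].
by apply/mem_set; split => // a; exact: YZ.
Qed.

Definition conf_incl (y : conf m Y) : conf m Z :=
  exist (fun z => z \in conf m Z) _ (conf_incl_subproof y).

End ConfInclusion.

(* Abstract complexes; a simplex with k.+1 vertices is a k-cell. Elements of V
   that are in no simplex are not vertices of the complex. *)
Record simplicial_complex (V : finType) := SimplicialComplex {
  simplices :> {set {set V}};
  simplices_neq0 : finset.set0 \notin simplices;
  simplices_face : forall s t : {set V},
    s \in simplices -> t \subset s -> t != finset.set0 -> t \in simplices }.

Section Complex.
Context (R : realType) (V : finType) (K : simplicial_complex V).

Definition complex_dim : nat := \max_(s in simplices K) #|s|.-1.

(* A point of the realization is the family of its barycentric coordinates. As V
   is finite, the product topology is the usual topology of the polyhedron. *)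
Definition support (p : {ptws V -> R}) : {set V} := finset (fun v => p v != 0).

Definition realization : set {ptws V -> R} :=
  [set p | [/\ forall v, 0 <= p v, \sum_v p v = 1 & support p \in simplices K]].

Definition open_cell (s : {set V}) : set {ptws V -> R} :=
  [set p | realization p /\ support p = s].

Definition free_edge (e : {set V}) : Prop :=
  [/\ e \in simplices K, #|e| = 2%N,
      forall s, s \in simplices K -> e \subset s -> s = e &
      forall s, s \in simplices K -> #|s| = 3%N ->
        ~ (open_cell e `<=` closure (open_cell s))].

End Complex.
Arguments open_cell R {V} K s.
Arguments free_edge R {V} K e.
Arguments realization R {V} K.

(* Main.v *)
(** Write [Y] for the configurations avoiding [x], [B] for all configurations in
    the complex, and [Z] for the configurations of [n - 1] points avoiding [x]. A
    configuration whose [a]-th point is closer to [x] than all the others, on the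
    free edge, is a point of [Z] together with a position on an interval; so [B]
    is [Y] with [n] handles [Z * R] glued in, and its fundamental group is
    generated by that of [Y] and one stable letter per handle, [Y] and [Z] being
    path connected.

    Counting the crossings of the walls maps the stable letters to a basis of a
    free group. For the other factor, both embeddings of [Z] into [Y] next to the
    [a]-th wall are sections of the map forgetting the [a]-th point. This
    splitting turns the crossing of a wall into an explicit bijection of
    [G := pi1 Y], compatible with right translations; hence the right regular
    action of [G] on itself extends to an action of [pi1 B], and [G] embeds. *)
From HB Require Import structures.
Require Import Defs.
From mathcomp Require Import all_boot all_order all_algebra.
From mathcomp Require Import all_classical reals topology normedtype sequences homotopy.
From mathcomp Require Import ring lra.

Set Implicit Arguments.
Unset Strict Implicit.
Unset Printing Implicit Defensive.

Import Order.TTheory GRing.Theory Num.Theory.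
Import numFieldNormedType.Exports.

Local Open Scope classical_set_scope.
Local Open Scope ring_scope.

(** * Paths, bisection and cocycles *)

(** The group of [B] is an HNN extension with one stable letter per wall, over the group of [Z]
    mapped to that of [Y] on the two sides of the wall. Normal forms are avoided: a factor embeds as
    soon as some homomorphism out of [pi1 B] detects it, so the point is to define such
    homomorphisms handle by handle. Base points obstruct this, since a handle meets [Y] in two
    pieces, away from the base point. Hence homomorphisms are replaced by a [cocycle] on all paths;
    these glue over any open cover.

    To let the stable letter act on [G], a bijection [theta] is needed with
    [theta (g * h) = theta g * h'] whenever [h] and [h'] come from the same class of [Z] on the two
    sides. For two isomorphic subgroups this would require coset spaces of equal size. Here both
    are, up to conjugation, complements of the same kernel, that of forgetting the [a]-th point:
    [theta] keeps the kernel part of [g] and exchanges the complementary part. The constant [k] in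
    [swap] accounts for a path joining the two sides. *)

Lemma pair_continuous_at (S T U : topologicalType) (f : S -> T) (g : S -> U) s :
  {for s, continuous f} -> {for s, continuous g} ->
  {for s, continuous (fun s => (f s, g s))}.
Proof. by move=> cf cg; exact: (cvg_pair cf cg). Qed.

Section PathCalculus.
Context (R : realType).
Local Notation I := (unit_interval R).
Local Notation one := classical_sets.one.

Section Paths.
Context (T : topologicalType).
Implicit Types (sigma tau : I -> T) (Q : I * I -> T).

Definition lhalf sigma (t : I) : T := sigma (clamp (2^-1 * ival t + 0)).
Definition rhalf sigma (t : I) : T := sigma (clamp (2^-1 * ival t + 2^-1)).
Definition flip_path sigma (t : I) : T := sigma (clamp (-1 * ival t + 1)).
Definition join_path sigma tau (t : I) : T :=
  if 2 * ival t + -1 <= 0 then sigma (clamp (2 * ival t + 0))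
  else tau (clamp (2 * ival t + -1)).

Lemma clamp_fun_continuous sigma (S : topologicalType) (a : S -> R) :
  continuous sigma -> continuous a -> continuous (fun s => sigma (clamp (a s))).
Proof.
move=> cs ca s; apply: (@continuous_comp _ _ _ (clamp \o a) sigma); last exact: cs.
exact: clamp_comp_continuous.
Qed.

Lemma affine_ival_continuous (k l : R) : continuous (fun t : I => k * ival t + l).
Proof. by apply: affine_continuous; exact: ival_continuous. Qed.

Lemma lhalf_continuous sigma : continuous sigma -> continuous (lhalf sigma).
Proof. by move=> cs; apply: clamp_fun_continuous => //; exact: affine_ival_continuous. Qed.

Lemma rhalf_continuous sigma : continuous sigma -> continuous (rhalf sigma).
Proof. by move=> cs; apply: clamp_fun_continuous => //; exact: affine_ival_continuous. Qed.

Lemma flip_path_continuous sigma : continuous sigma -> continuous (flip_path sigma).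
Proof. by move=> cs; apply: clamp_fun_continuous => //; exact: affine_ival_continuous. Qed.

Lemma join_path_continuous sigma tau : continuous sigma -> continuous tau ->
  sigma one = tau zero -> continuous (join_path sigma tau).
Proof.
move=> cs ct st; apply: paste_continuous.
- exact: affine_ival_continuous.
- by apply: clamp_fun_continuous => //; exact: affine_ival_continuous.
- by apply: clamp_fun_continuous => //; exact: affine_ival_continuous.
- move=> t t0; rewrite t0 (@clamp_le0 _ 0) // -st clamp_ge1 //; lra.
Qed.

Lemma clamp0 : clamp (0 : R) = zero. Proof. by []. Qed.
Lemma clamp1 : clamp (1 : R) = one. Proof. by []. Qed.

Lemma lhalf0 sigma : lhalf sigma zero = sigma zero.
Proof. by rewrite /lhalf ival0 mulr0 addr0. Qed.
Lemma rhalf1 sigma : rhalf sigma one = sigma one.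
Proof. by rewrite /rhalf ival1 clamp_ge1 //; lra. Qed.
Lemma lhalf1 sigma : lhalf sigma one = rhalf sigma zero.
Proof. by rewrite /lhalf /rhalf ival1 ival0 mulr0 mulr1 addr0 add0r. Qed.

Lemma flip_path0 sigma : flip_path sigma zero = sigma one.
Proof. by rewrite /flip_path ival0 mulr0 add0r. Qed.
Lemma flip_path1 sigma : flip_path sigma one = sigma zero.
Proof. by rewrite /flip_path ival1 mulr1 addNr. Qed.
Lemma join_path0 sigma tau : join_path sigma tau zero = sigma zero.
Proof. by rewrite /join_path ival0 ifT ?mulr0 ?addr0 //; lra. Qed.
Lemma join_path1 sigma tau : join_path sigma tau one = tau one.
Proof.
rewrite /join_path ival1 ifF; last by apply/negbTE; rewrite -ltNge; lra.
by rewrite clamp_ge1 //; lra.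
Qed.

Lemma lhalf_join_path sigma tau : lhalf (join_path sigma tau) = sigma.
Proof.
apply/funext => t; have t0 := ival_ge0 t; have t1 := ival_le1 t.
rewrite /lhalf /join_path clamp_id; [|lra|lra]; rewrite ifT; last by lra.
by rewrite -[t in RHS]ivalK; congr (sigma (clamp _)); lra.
Qed.

Lemma rhalf_join_path sigma tau : sigma one = tau zero ->
  rhalf (join_path sigma tau) = tau.
Proof.
move=> st; apply/funext => t; have t0 := ival_ge0 t; have t1 := ival_le1 t.
rewrite /rhalf /join_path clamp_id; [|lra|lra].
case: ifPn => [t2|_]; last by rewrite -[t in RHS]ivalK; congr (tau (clamp _)); lra.
have t3 : ival t = 0 by lra.
have -> : t = zero by rewrite -[LHS]ivalK t3.
by rewrite -st ival0 clamp_ge1 //; lra.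
Qed.

Lemma cat_halves sigma : join_path (lhalf sigma) (rhalf sigma) = sigma.
Proof.
apply/funext => t; have t0 := ival_ge0 t; have t1 := ival_le1 t.
rewrite /join_path; case: ifPn => [t2|]; last rewrite -ltNge => t2.
  rewrite /lhalf clamp_id; [|lra|lra].
  by rewrite -[t in RHS]ivalK; congr (sigma (clamp _)); lra.
rewrite /rhalf clamp_id; [|lra|lra].
by rewrite -[t in RHS]ivalK; congr (sigma (clamp _)); lra.
Qed.

Definition subsquare Q (p q w : R) (st : I * I) : T :=
  Q (clamp (w * ival st.1 + p), clamp (w * ival st.2 + q)).

Lemma subsquare_continuous Q p q w :
  continuous Q -> continuous (subsquare Q p q w).
Proof.
move=> cQ; apply: pair_comp_continuous => //; apply: affine_continuous.
  exact: ival_fst_continuous.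
exact: ival_snd_continuous.
Qed.

Lemma subsquare_comp Q p q w p' q' w' :
  0 <= p' -> 0 <= q' -> 0 <= w' -> p' + w' <= 1 -> q' + w' <= 1 ->
  subsquare (subsquare Q p q w) p' q' w' =
  subsquare Q (w * p' + p) (w * q' + q) (w * w').
Proof.
move=> p0 q0 w0 pw qw; apply/funext => -[s t]; rewrite /subsquare /=.
have := ival_ge0 s; have := ival_le1 s; have := ival_ge0 t; have := ival_le1 t.
move=> ????.
rewrite !clamp_id; [|nra|nra|nra|nra].
by congr (Q (clamp _, clamp _)); lra.
Qed.

Lemma fst_slice_continuous Q (t : I) : continuous Q -> continuous (fun s => Q (s, t)).
Proof.
move=> cQ s; apply: (@continuous_comp _ _ _ (fun s => (s, t)) Q); last exact: cQ.
by apply: pair_continuous_at; [exact: cvg_id|exact: cst_continuous].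
Qed.

Lemma snd_slice_continuous Q (s : I) : continuous Q -> continuous (fun t => Q (s, t)).
Proof.
move=> cQ t; apply: (@continuous_comp _ _ _ (fun t => (s, t)) Q); last exact: cQ.
by apply: pair_continuous_at; [exact: cst_continuous|exact: cvg_id].
Qed.

Lemma dist_subsquare (p p' w s e : R) : `|p - p'| < e / 2 -> `|w| < e / 2 ->
  0 <= s -> s <= 1 -> `|p - (w * s + p')| < e.
Proof.
move=> /ltr_normlP[p1 p2] /ltr_normlP[w1 w2] s0 s1.
by apply/ltr_normlP; split; nra.
Qed.

(** * Subdivision of squares and paths subordinate to an open cover *)

Section Bisection.
Context (J : Type) (U : J -> set T).
Hypotheses (U_open : forall i, open (U i)) (U_cover : forall b, exists i, U i b).

(** Lebesgue number lemma, with sizes measured by powers of one half. Compactness in its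
    near-covering form yields one [N] for all corners at once; squares sticking out of the unit
    square are harmless because of [clamp]. *)
Lemma subsquare_in_cover Q : continuous Q -> exists N : nat,
  forall p q, 0 <= p <= 1 -> 0 <= q <= 1 ->
  exists i, forall st, U i (subsquare Q p q (2^-1 ^+ N) st).
Proof.
move=> cQ.
have cK : compact (`[0, 1]%classic `*` `[0, 1]%classic : set (R * R)).
  by apply: compact_setX; exact: segment_compact.
have := (compact_near_coveringP _).1 cK nat \oo
  (fun N pq => exists i, forall st, U i (subsquare Q pq.1 pq.2 (2^-1 ^+ N) st)) _.
case=> [[p q] _|N _ HN].
  have [i Ui] := U_cover (Q (clamp p, clamp q)).
  have cQ' : continuous (fun pq : R * R => Q (clamp pq.1, clamp pq.2)).
    apply: pair_comp_continuous => // z; [exact: cvg_fst|exact: cvg_snd].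
  have : nbhs (p, q) [set pq | U i (Q (clamp pq.1, clamp pq.2))].
    by apply: (cQ' (p, q)); apply: open_nbhs_nbhs.
  move=> /nbhs_ballP[e /= e0 He].
  have small : \forall N \near \oo, `|(2^-1 : R) ^+ N| < e / 2.
    have := @cvg_expr R 2^-1; rewrite ger0_norm ?invr_ge0 //.
    have h : (2^-1 : R) < 1 by lra.
    move=> /(_ h) /cvgrPdist_lt /(_ (e / 2)) /(_ (divr_gt0 e0 (ltr0Sn _ _))).
    by apply: filterS => k; rewrite sub0r normrN.
  (* Half of the radius [e] is spent on moving the corner, half on the side of the square. *)
  exists (ball (p, q) (e / 2), [set N | `|(2^-1 : R) ^+ N| < e / 2]).
    by split => //; apply: nbhsx_ballx; rewrite divr_gt0.
  move=> [[p' q'] N] /= [[pp qq] Ne]; exists i => -[s t].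
  apply: (He (_, _)); split => /=.
  - exact: (dist_subsquare pp Ne (ival_ge0 s) (ival_le1 s)).
  - exact: (dist_subsquare qq Ne (ival_ge0 t) (ival_le1 t)).
exists N => p q p01 q01.
by have := HN N (leqnn N) (p, q); apply; split => /=; rewrite in_itv.
Qed.

Lemma square_ind (P : (I * I -> T) -> Prop) :
  (forall Q i, continuous Q -> (forall st, U i (Q st)) -> P Q) ->
  (forall Q, continuous Q ->
    P (subsquare Q 0 0 2^-1) -> P (subsquare Q 2^-1 0 2^-1) ->
    P (subsquare Q 0 2^-1 2^-1) -> P (subsquare Q 2^-1 2^-1 2^-1) -> P Q) ->
  forall Q, continuous Q -> P Q.
Proof.
move=> Psmall Pstep Q cQ; have [N HN] := subsquare_in_cover cQ.
(* Induction from the smallest squares, of side [2^-1 ^+ N] at [k = 0], up to the unit square at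
   [k = N]. *)
suff H k : (k <= N)%N -> forall p q, 0 <= p -> 0 <= q ->
    p + 2^-1 ^+ (N - k) <= 1 -> q + 2^-1 ^+ (N - k) <= 1 ->
    P (subsquare Q p q (2^-1 ^+ (N - k))).
  have := H N (leqnn N) 0 0; rewrite subnn expr0 => /(_ (lexx _) (lexx _)).
  have -> : subsquare Q 0 0 1 = Q.
    by apply/funext => -[s t]; rewrite /subsquare !mul1r !addr0 !ivalK.
  by apply; lra.
elim: k => [_|k IHk kN] p q p0 q0; rewrite ?subn0 => pw qw.
  have w0 : 0 < (2^-1 : R) ^+ N by rewrite exprn_gt0 // invr_gt0.
  have [||i Hi] := HN p q; [apply/andP; split; lra..|].
  by apply: (Psmall _ i) => //; exact: subsquare_continuous.
have Nk : (N - k)%N = (N - k.+1).+1 by rewrite subnSK.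
move: IHk => /(_ (ltnW kN)); rewrite Nk exprSr => IHk.
move: pw qw IHk; set w := 2^-1 ^+ _ => pw qw IHk.
have w0 : 0 < w by rewrite exprn_gt0 // invr_gt0.
apply: Pstep; first exact: subsquare_continuous.
all: rewrite subsquare_comp; [|lra..].
all: apply: IHk; lra.
Qed.

Lemma path_ind (P : (I -> T) -> Prop) :
  (forall sigma i, continuous sigma -> (forall t, U i (sigma t)) -> P sigma) ->
  (forall sigma, continuous sigma ->
    P (lhalf sigma) -> P (rhalf sigma) -> P sigma) ->
  forall sigma, continuous sigma -> P sigma.
Proof.
move=> Psmall Pstep sigma cs.
(* A path is a square that ignores its second coordinate; the two lower quarters are then its
   halves. *)
pose Q (st : I * I) := sigma st.1.
have cQ : continuous Q.
  by move=> st; apply: continuous_comp; [exact: cvg_fst|exact: cs].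
have sq := @square_ind (fun Q0 => P (fun s => Q0 (s, zero))).
change (P (fun s => Q (s, zero))); move: Q cQ; apply: sq.
  by move=> Q' i cQ' UQ'; apply: (Psmall _ i) => //; exact: fst_slice_continuous.
move=> Q' cQ' P00 P10 _ _; apply: Pstep; first exact: fst_slice_continuous.
- by move: P00; rewrite /subsquare /= ival0 mulr0 addr0 clamp0.
- by move: P10; rewrite /subsquare /= ival0 mulr0 addr0 clamp0.
Qed.

End Bisection.

Lemma path_ends sigma a b : continuous sigma -> sigma zero = a ->
  sigma one = b -> exists f : {path I from a to b}, f = sigma :> (I -> T).
Proof. by move=> cs s0 s1; exists (mk_path cs s0 s1). Qed.

(* A functor from the fundamental groupoid to [M], presented on unbundled maps so
   that endpoints need no casts; nothing is required of discontinuous maps. *)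
Record cocycle (M : groupType) (L : (I -> T) -> M) : Prop := Cocycle {
  cocycle_half : forall sigma, continuous sigma ->
    L sigma = (L (lhalf sigma) * L (rhalf sigma))%g;
  cocycle_cst : forall b, L (fun=> b) = 1%g;
  cocycle_sq : forall Q, continuous Q ->
    (L (fun s => Q (s, zero)) * L (fun t => Q (one, t)) =
     L (fun t => Q (zero, t)) * L (fun s => Q (s, one)))%g }.

Section CocycleTheory.
Context (M : groupType) (L : (I -> T) -> M) (cL : cocycle L).

Lemma cocycle_cat sigma tau : continuous sigma -> continuous tau ->
  sigma one = tau zero -> L (join_path sigma tau) = (L sigma * L tau)%g.
Proof.
move=> cs ct st; rewrite (cocycle_half cL) ?lhalf_join_path ?rhalf_join_path //.
exact: join_path_continuous.
Qed.

Lemma cocycle_rev sigma : continuous sigma -> L (flip_path sigma) = (L sigma)^-1%g.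
Proof.
move=> cs; apply: (mulgI (L sigma)); rewrite mulgV.
(* The square [sigma (s - t)], clamped: its bottom is [sigma], its right side the reversed path, and
   the other two sides are constant. *)
pose Q (st : I * I) := sigma (clamp (1 * ival st.1 + (-1 * ival st.2 + 0))).
have cQ : continuous Q.
  apply: clamp_fun_continuous => //.
  have c1 := @ival_fst_continuous R; have c2 := @ival_snd_continuous R.
  move=> st; apply: cvgD; first by apply: cvgM; [exact: cvg_cst|exact: c1].
  by apply: cvgD; [apply: cvgM; [exact: cvg_cst|exact: c2]|exact: cvg_cst].
have := cocycle_sq cL cQ; rewrite /Q /= ival0 ival1.
have -> : (fun s => sigma (clamp (1 * ival s + (-1 * 0 + 0)))) = sigma.
  by apply/funext => s; rewrite -[s in RHS]ivalK; congr (sigma (clamp _)); lra.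
have -> : (fun s => sigma (clamp (1 * 1 + (-1 * ival s + 0)))) = flip_path sigma.
  by apply/funext => s; congr (sigma (clamp _)); lra.
have -> : (fun s => sigma (clamp (1 * 0 + (-1 * ival s + 0)))) = fun=> sigma zero.
  apply/funext => s; rewrite clamp_le0 //; have := ival_ge0 s; lra.
have -> : (fun s => sigma (clamp (1 * ival s + (-1 * 1 + 0)))) = fun=> sigma zero.
  apply/funext => s; rewrite clamp_le0 //; have := ival_le1 s; lra.
by rewrite !(cocycle_cst cL) mulg1.
Qed.

Lemma cocycle_homotopic x y (f g : {path I from x to y}) :
  homotopic f g -> L f = L g.
Proof.
case=> H [cH H0 H1 Hxy]; have := cocycle_sq cL cH.
rewrite (funext H0) (funext H1).
rewrite (_ : (fun t => H (one, t)) = fun=> y); last first.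
  by apply/funext => t; exact: (Hxy t).2.
rewrite (_ : (fun t => H (zero, t)) = fun=> x); last first.
  by apply/funext => t; exact: (Hxy t).1.
by rewrite !(cocycle_cst cL) mulg1 mul1g.
Qed.

End CocycleTheory.

Lemma cocycle_one (M : groupType) : cocycle (fun=> 1%g : M).
Proof. by split => // *; rewrite ?mulg1. Qed.

Lemma cocycle_morph (M M' : groupType) (L : (I -> T) -> M) (phi : M -> M') :
  {morph phi : x y / (x * y)%g} -> cocycle L -> cocycle (phi \o L).
Proof.
move=> phiM cL; split => [s cs|b|Q cQ] /=.
- by rewrite -phiM -(cocycle_half cL).
- rewrite (cocycle_cst cL); apply: (mulgI (phi 1%g)).
  by rewrite -phiM !mulg1.
- by rewrite -!phiM (cocycle_sq cL).
Qed.

End Paths.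

Lemma cocycle_comp (S T : topologicalType) (h : S -> T) (M : groupType)
    (L : (I -> T) -> M) : continuous h -> cocycle L ->
  cocycle (fun sigma => L (h \o sigma)).
Proof.
move=> ch cL; have chc (U : topologicalType) (f : U -> S) :
    continuous f -> continuous (h \o f).
  by move=> cf u; apply: continuous_comp; [exact: cf|exact: ch].
split=> [s cs|b|Q cQ].
- by rewrite (cocycle_half cL) //; exact: chc.
- exact: (cocycle_cst cL).
- by have := cocycle_sq cL (chc _ _ cQ).
Qed.

(** Pasting of four commuting squares; [v1], [v2], [h1], [h2] are the inner edges. *)
Lemma mulg_grid (M : groupType) (b1 b2 r1 r2 l1 l2 t1 t2 v1 v2 h1 h2 : M) :
  (b1 * v1 = l1 * h1)%g -> (b2 * r1 = v1 * h2)%g -> (h1 * v2 = l2 * t1)%g ->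
  (h2 * r2 = v2 * t2)%g -> (b1 * b2 * (r1 * r2) = l1 * l2 * (t1 * t2))%g.
Proof.
move=> e1 e2 e3 e4; rewrite -mulgA (mulgA b2) e2 -(mulgA v1) e4 (mulgA b1) e1.
by rewrite -(mulgA l1) (mulgA h1) e3 -!mulgA.
Qed.

(** * Gluing local cocycles over an open cover *)

Section ExtendCocycle.
Context (T : topologicalType) (M : groupType) (J : Type) (U : J -> set T).
Context (tau : J -> (I -> T) -> M).
Hypotheses (U_open : forall i, open (U i)) (U_cover : forall b, exists i, U i b).
Hypothesis tau_agree : forall i j sigma, continuous sigma ->
  (forall t, U i (sigma t)) -> (forall t, U j (sigma t)) ->
  tau i sigma = tau j sigma.
Hypothesis tau_half : forall i sigma, continuous sigma ->
  (forall t, U i (sigma t)) ->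
  tau i sigma = (tau i (lhalf sigma) * tau i (rhalf sigma))%g.
Hypothesis tau_cst : forall i b, U i b -> tau i (fun=> b) = 1%g.
Hypothesis tau_sq : forall i Q, continuous Q -> (forall st, U i (Q st)) ->
  (tau i (fun s => Q (s, zero)) * tau i (fun t => Q (one, t)) =
   tau i (fun t => Q (zero, t)) * tau i (fun s => Q (s, one)))%g.

(* Values of the extension computed by repeated bisection. They are unique without
   any comparison of subdivisions, since [tau] itself is compatible with bisection. *)
Inductive transport : (I -> T) -> M -> Prop :=
| transport_small i sigma : continuous sigma -> (forall t, U i (sigma t)) ->
    transport sigma (tau i sigma)
| transport_half sigma m m' : continuous sigma -> transport (lhalf sigma) m ->
    transport (rhalf sigma) m' -> transport sigma (m * m')%g.

(** On a path inside some [U i] every derivation evaluates to [tau i], because [tau_half] undoes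
    each bisection and [tau_agree] removes the choice of the index. Two derivations are compared
    node by node until one of them stops, where the path is of this kind. *)
Lemma transport_unique sigma m m' :
  transport sigma m -> transport sigma m' -> m = m'.
Proof.
have small i s n : transport s n -> (forall t, U i (s t)) -> n = tau i s.
  elim=> {s n} [j s cs Us Us'|s n n' cs _ IH1 _ IH2 Us]; first exact: tau_agree.
  rewrite IH1; last by move=> t; exact: Us.
  by rewrite IH2 -?tau_half // => t; exact: Us.
move=> H; elim: H m' => {sigma m} [i s cs Us m' /(@small i)/(_ Us) -> //|].
move=> s n n' cs _ IH1 _ IH2 m' H.
case: H cs IH1 IH2 => {s m'} [i s _ Us|s k k' _ H1 H2] cs IH1 IH2.
  rewrite (tau_half cs Us); congr (_ * _)%g.
    by apply: IH1; apply: transport_small; [exact: lhalf_continuous|move=> t; exact: Us].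
  by apply: IH2; apply: transport_small; [exact: rhalf_continuous|move=> t; exact: Us].
by rewrite (IH1 _ H1) (IH2 _ H2).
Qed.

Lemma transport_exists sigma : continuous sigma -> exists m, transport sigma m.
Proof.
have pind := @path_ind T J U U_open U_cover (fun s => exists m, transport s m).
move: sigma; apply: pind => [s i cs Us|s cs [m Hm] [m' Hm']].
  by exists (tau i s); exact: transport_small.
by exists (m * m')%g; exact: transport_half.
Qed.

(** A van Kampen theorem for paths instead of loops, hence without connectedness of the overlaps.
    The relation of a square follows from those of its quarters, down to squares inside one
    [U i]. *)
Lemma extend_cocycle : exists L : (I -> T) -> M, cocycle L /\
  forall i sigma, continuous sigma -> (forall t, U i (sigma t)) ->
    L sigma = tau i sigma.
Proof.
pose L sigma : M := xget 1%g [set m | transport sigma m].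
have LP sigma : continuous sigma -> transport sigma (L sigma).
  by move=> /transport_exists[m Hm]; exact: (xgetI _ Hm).
have Lsmall i sigma : continuous sigma -> (forall t, U i (sigma t)) ->
    L sigma = tau i sigma.
  by move=> cs Us; apply: transport_unique (LP _ cs) _; exact: transport_small.
have Lhalf sigma : continuous sigma -> L sigma = (L (lhalf sigma) * L (rhalf sigma))%g.
  move=> cs; apply: transport_unique (LP _ cs) _; apply: transport_half => //; apply: LP.
    exact: lhalf_continuous.
  exact: rhalf_continuous.
exists L; split=> //; split => // [b|Q cQ].
  have [i Ui] := U_cover b; rewrite (Lsmall i) ?tau_cst //; exact: cst_continuous.
have cx (P : I * I -> T) (t : I) := @fst_slice_continuous T P t.
have cy (P : I * I -> T) (s : I) := @snd_slice_continuous T P s.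
have sq := @square_ind T J U U_open U_cover (fun Q =>
  (L (fun s => Q (s, zero)) * L (fun t => Q (one, t)) =
   L (fun t => Q (zero, t)) * L (fun s => Q (s, one)))%g).
move: Q cQ; apply: sq => [Q i cQ UQ|Q cQ].
  by rewrite !(Lsmall i) ?tau_sq //; [exact: cx|exact: cy|exact: cy|exact: cx].
have cl : clamp (2^-1 + 2^-1 : R) = one by rewrite clamp_ge1 //; lra.
rewrite (Lhalf _ (cx Q zero cQ)) (Lhalf _ (cy Q one cQ)).
rewrite (Lhalf _ (cy Q zero cQ)) (Lhalf _ (cx Q one cQ)).
rewrite /subsquare /lhalf /rhalf /= ival0 ival1 !mulr0 !mulr1 !add0r !addr0 clamp0 cl.
exact: mulg_grid.
Qed.

End ExtendCocycle.
End PathCalculus.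

(** * The tautological cocycle of a path connected space *)

Section LoopCocycle.
Context (R : realType).
Local Notation I := (unit_interval R).
Local Notation one := classical_sets.one.

Definition reachable (T : topologicalType) (a b : T) : Prop :=
  exists sigma : I -> T, [/\ continuous sigma, sigma zero = a & sigma one = b].

(** The parameter square is convex: linear interpolation of the coordinates is a homotopy, which [Q]
    carries to [T]. *)
Lemma homotopic_in_square (T : topologicalType) (x y : T) (Q : I * I -> T)
    (p q : {path I from x to y}) (a1 a2 b1 b2 : I -> R) :
  continuous Q -> continuous a1 -> continuous a2 -> continuous b1 ->
  continuous b2 ->
  a1 zero = b1 zero -> a2 zero = b2 zero -> a1 one = b1 one -> a2 one = b2 one ->
  (forall t, p t = Q (clamp (a1 t), clamp (a2 t))) ->
  (forall t, q t = Q (clamp (b1 t), clamp (b2 t))) -> homotopic p q.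
Proof.
move=> cQ ca1 ca2 cb1 cb2 e10 e20 e11 e21 pE qE.
have cfst (a : I -> R) : continuous a -> continuous (fun s : I * I => a s.1).
  by move=> ca s; apply: (@continuous_comp _ _ _ fst a); [exact: cvg_fst|exact: ca].
have cint (a b : I -> R) : continuous a -> continuous b ->
    continuous (fun s : I * I => a s.1 + ival s.2 * (b s.1 - a s.1)).
  move=> ca cb s; apply: cvgD; first exact: (cfst _ ca).
  apply: cvgM; first exact: ival_snd_continuous.
  by apply: cvgB; [exact: (cfst _ cb)|exact: (cfst _ ca)].
exists (fun s => Q (clamp (a1 s.1 + ival s.2 * (b1 s.1 - a1 s.1)),
                    clamp (a2 s.1 + ival s.2 * (b2 s.1 - a2 s.1)))); split.
- by apply: pair_comp_continuous => //; exact: cint.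
- by move=> s /=; rewrite ival0 !mul0r !addr0 pE.
- by move=> s /=; rewrite ival1 !mul1r !subrKC qE.
- move=> t /=; rewrite -e10 -e20 -e11 -e21 !subrr !mulr0 !addr0 -!pE.
  by rewrite path_zero path_one.
Qed.

Section Based.
Context (T : topologicalType) (x0 : T) (gam : forall b, {path I from x0 to b}).

Definition closeup a b (f : {path I from a to b}) : pi1 R x0 :=
  pi1_class (concat (gam a) (concat f (reverse (gam b)))).

Lemma closeup_homotopic a b (f g : {path I from a to b}) :
  homotopic f g -> closeup f = closeup g.
Proof.
move=> fg; apply/pi1_classP; apply: homotopic_concat; first exact: homotopic_refl.
by apply: homotopic_concat => //; exact: homotopic_refl.
Qed.

Lemma closeup_concat a b c (f : {path I from a to b}) (g : {path I from b to c}) :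
  closeup (concat f g) = (closeup f * closeup g)%g.
Proof.
rewrite [RHS]pi1_mulE; apply/pi1_classP/homotopic_sym.
apply: homotopic_trans; first exact/homotopic_sym/homotopic_concatA.
apply: homotopic_concat; first exact: homotopic_refl.
apply: homotopic_trans; first exact/homotopic_sym/homotopic_concatA.
apply: (@homotopic_trans _ _ _ _ _ (concat f (concat g (reverse (gam c)))));
  last exact: homotopic_concatA.
apply: homotopic_concat; first exact: homotopic_refl.
apply: homotopic_trans; first exact: homotopic_concatA.
apply: homotopic_trans; last exact: homotopic_const_concat.
by apply: homotopic_concat; [exact: homotopic_reverse_concat|exact: homotopic_refl].
Qed.

Lemma closeup_const b : closeup (const_path R b) = 1%g.
Proof.
apply/pi1_classP; apply: homotopic_trans; last exact: homotopic_concat_reverse (gam b).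
by apply: homotopic_concat; [exact: homotopic_refl|exact: homotopic_const_concat].
Qed.

(** The endpoints are determined by the underlying map; this makes [loop_cocycle] independent of the
    typing chosen for a path. *)
Lemma closeup_fun a b a' b' (f : {path I from a to b}) (f' : {path I from a' to b'}) :
  f = f' :> (I -> T) -> closeup f = closeup f'.
Proof.
move=> ff'; have ea : a = a' by transitivity (f zero); [rewrite path_zero|rewrite ff' path_zero].
have eb : b = b' by transitivity (f one); [rewrite path_one|rewrite ff' path_one].
move: f f' ff'; rewrite ea eb => f f' ff'.
by have -> : f = f' by apply/path_eqP => t; rewrite ff'.
Qed.

(** [gam x0] is an arbitrary loop, so closing up a loop at [x0] conjugates its class by that of
    [gam x0]; the outer factors undo this. *)
Definition loop_cocycle (sigma : I -> T) : pi1 R x0 :=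
  ((closeup (gam x0))^-1 *
   xget 1 [set g | exists a b (f : {path I from a to b}), f = sigma :> (I -> T) /\
     g = closeup f] * closeup (gam x0))%g.

Lemma loop_cocycleE a b (f : {path I from a to b}) :
  loop_cocycle f = ((closeup (gam x0))^-1 * closeup f * closeup (gam x0))%g.
Proof.
congr (_ * _ * _)%g; apply: xget_unique; first by exists a, b, f.
by move=> g [a' [b' [f' [ff' ->]]]]; exact: closeup_fun.
Qed.

Lemma loop_cocycle_loop (f : {path I from x0 to x0}) :
  loop_cocycle f = pi1_class f.
Proof.
have closeupE (g : {path I from x0 to x0}) : closeup g =
    (pi1_class (gam x0) * pi1_class g * (pi1_class (gam x0))^-1)%g.
  have mE (h h' : {path I from x0 to x0}) :
    (pi1_class h * pi1_class h')%g = pi1_class (concat h h') := pi1_mulE h h'.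
  by rewrite [(_^-1)%g]pi1_invE -mulgA (mE g) mE.
by rewrite loop_cocycleE !closeupE mulgK !mulgA mulgVK mulVg mul1g.
Qed.

Lemma cocycle_loop_cocycle : cocycle loop_cocycle.
Proof.
have cE a b c (f : {path I from a to b}) (g : {path I from b to c}) s1 s2 :
    f = s1 :> (I -> T) -> g = s2 :> (I -> T) ->
    loop_cocycle (concat f g) = (loop_cocycle s1 * loop_cocycle s2)%g.
  move=> <- <-; rewrite (@loop_cocycleE a c (concat f g)) !loop_cocycleE closeup_concat.
  by rewrite -!mulgA mulVKg.
split=> [sigma cs|b|Q cQ].
- have [f fE] := path_ends (lhalf_continuous cs) erefl (lhalf1 sigma).
  have [g gE] := path_ends (rhalf_continuous cs) erefl erefl.
  rewrite -(cE _ _ _ _ _ _ _ fE gE); congr loop_cocycle.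
  by rewrite -[LHS]cat_halves; apply/funext => t; rewrite concatE fE gE.
- rewrite (@loop_cocycleE b b (const_path R b)) closeup_const.
  by rewrite mulg1 mulVg.
- have cx := fst_slice_continuous; have cy := snd_slice_continuous.
  have [b bE] := path_ends (cx _ _ Q zero cQ) erefl erefl.
  have [r rE] := path_ends (cy _ _ Q one cQ) erefl erefl.
  have [l lE] := path_ends (cy _ _ Q zero cQ) erefl erefl.
  have [t tE] := path_ends (cx _ _ Q one cQ) erefl erefl.
  rewrite -(cE _ _ _ _ _ _ _ bE rE) -(cE _ _ _ _ _ _ _ lE tE).
  rewrite (@loop_cocycleE _ _ (concat b r)) (@loop_cocycleE _ _ (concat l t)).
  congr (_ * _ * _)%g; apply: closeup_homotopic.
  (* Along either concatenation one coordinate is [2 s] and the other [2 s - 1], both clamped: each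
     moves during one half of the time and rests during the other. *)
  have cc l' : continuous (fun s : I => ival (clamp (2 * ival s + l') : I)).
    by apply: (clamp_fun_continuous (@ival_continuous R)); exact: affine_ival_continuous.
  have h0 : clamp (-1 : R) = zero by rewrite clamp_le0 //; lra.
  have h1 : clamp (2 : R) = one by rewrite clamp_ge1 //; lra.
  have h2 : 2 - 1 = 1 :> R by lra.
  apply: (homotopic_in_square cQ (cc 0) (cc (-1)) (cc (-1)) (cc 0));
    rewrite ?ival0 ?ival1 ?mulr0 ?mulr1 ?add0r ?addr0 ?h0 ?h1 ?h2 ?clamp0 ?clamp1 //.
  + move=> s; rewrite concatE !ivalK bE rE.
    have := ival_ge0 s; have := ival_le1 s => s1 s0.
    by case: ifPn => s2; [rewrite (clamp_le0 s2)|rewrite (@clamp_ge1 _ (_ + 0)) //; lra].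
  + move=> s; rewrite concatE !ivalK lE tE.
    have := ival_ge0 s; have := ival_le1 s => s1 s0.
    by case: ifPn => s2; [rewrite (clamp_le0 s2)|rewrite (@clamp_ge1 _ (_ + 0)) //; lra].
Qed.

End Based.

Lemma loop_cocycle_exists (T : topologicalType) (x0 : T) :
  (forall b, reachable x0 b) ->
  exists E : (I -> T) -> pi1 R x0, cocycle E /\
    forall f : {path I from x0 to x0}, E f = pi1_class f.
Proof.
move=> pcT.
have pths b : exists f : {path I from x0 to b}, True.
  have [s [cs s0 s1]] := pcT b.
  by have [f _] := path_ends cs s0 s1; exists f.
pose gam b := projT1 (cid (pths b)).
by exists (loop_cocycle gam); split; [exact: cocycle_loop_cocycle|exact: loop_cocycle_loop].
Qed.

End LoopCocycle.

(** * Presented groups, bijections and monodromy *)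

Section PresLift.
Context (S : choiceType) (rel : word S -> word S -> Prop) (G : groupType).
Context (phi : S -> G).

Definition word_eval (w : word S) : G :=
  foldr (fun l g => (if l.2 then phi l.1 else (phi l.1)^-1) * g)%g 1%g w.

Lemma word_eval_cat u v : word_eval (u ++ v) = (word_eval u * word_eval v)%g.
Proof. by elim: u => [|l u IHu] /=; rewrite ?mul1g // IHu mulgA. Qed.

Hypothesis relP : forall u v, rel u v -> word_eval u = word_eval v.

Lemma pres_eq_eval u v : pres_eq rel u v -> word_eval u = word_eval v.
Proof.
elim=> {u v} // [u v w _ -> _ -> //|u u' v v' _ IHu _ IHv|s b].
  by rewrite !word_eval_cat IHu IHv.
by case: b; rewrite /= mulg1 ?mulgV ?mulVg.
Qed.

Definition pres_lift (a : pres_group rel) : G := word_eval (repr a).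

Lemma pres_liftE w : pres_lift (pres_class rel w) = word_eval w.
Proof. by apply: pres_eq_eval; exact: repr_pres_class. Qed.

Lemma pres_liftM : {morph pres_lift : a b / (a * b)%g}.
Proof. by move=> a b; rewrite [LHS]pres_liftE word_eval_cat. Qed.

End PresLift.

Lemma pres_group_ind (S : choiceType) (rel : word S -> word S -> Prop)
    (P : pres_group rel -> Prop) :
  P 1%g -> (forall a b, P a -> P b -> P (a * b)%g) ->
  (forall s, P (pres_class rel [:: (s, true)])) ->
  (forall a, P a -> P a^-1%g) -> forall a, P a.
Proof.
move=> P1 PM PS PV a; rewrite -[a]pres_classK.
elim: (repr a) => [|[s b] w IHw] //.
rewrite -cat1s -[pres_class _ _]pres_mulE; apply: PM => //.
case: b => //; have := PV _ (PS s).
by rewrite [(_^-1)%g]pres_invE.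
Qed.

Lemma morph_mulg_one (G H : groupType) (f : G -> H) :
  {morph f : a b / (a * b)%g} -> f 1%g = 1%g.
Proof. by move=> fM; apply: (mulgI (f 1%g)); rewrite -fM !mulg1. Qed.

Lemma morph_mulg_inv (G H : groupType) (f : G -> H) :
  {morph f : a b / (a * b)%g} -> forall a, f a^-1%g = (f a)^-1%g.
Proof.
by move=> fM a; apply: (mulgI (f a)); rewrite -fM !mulgV morph_mulg_one.
Qed.

Definition free_gen n (i : 'I_n) : free_group n := pres_class _ [:: (i, true)].

Section FreeProductLift.
Context (G K : groupType) (n : nat) (phi : G -> K) (t : 'I_n -> K).
Hypothesis phiM : {morph phi : a b / (a * b)%g}.

Definition free_lift : free_group n -> K := pres_lift t.

Lemma free_liftM : {morph free_lift : a b / (a * b)%g}.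
Proof. by apply: pres_liftM => u v. Qed.

Lemma free_lift_gen i : free_lift (free_gen i) = t i.
Proof. by rewrite /free_lift pres_liftE //= mulg1. Qed.

Definition free_product_letter (s : (G + free_group n)%type) : K :=
  match s with inl a => phi a | inr b => free_lift b end.

Lemma free_product_letterP u v :
  free_product_rel u v -> word_eval free_product_letter u = word_eval free_product_letter v.
Proof. by case=> a b; rewrite /= !mulg1 ?phiM ?free_liftM. Qed.

Definition free_product_lift : free_product G (free_group n) -> K :=
  pres_lift free_product_letter.

Lemma free_product_liftM : {morph free_product_lift : a b / (a * b)%g}.
Proof. by apply: pres_liftM; exact: free_product_letterP. Qed.

Lemma free_product_lift_inl a : free_product_lift (free_product_inl a) = phi a.
Proof.
by rewrite /free_product_lift pres_liftE ?mulg1 //=; [rewrite mulg1|exact: free_product_letterP].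
Qed.

Lemma free_product_lift_inr b : free_product_lift (free_product_inr b) = free_lift b.
Proof.
by rewrite /free_product_lift pres_liftE /= ?mulg1 //; exact: free_product_letterP.
Qed.

End FreeProductLift.

Section Bijections.
Context (F : Type).

Record self_bij := SelfBij { bij_fun : F -> F; bij_inv : F -> F;
  bij_funK : cancel bij_fun bij_inv; bij_invK : cancel bij_inv bij_fun }.

HB.instance Definition _ := gen_eqMixin self_bij.
HB.instance Definition _ := gen_choiceMixin self_bij.

Lemma bijP (p q : self_bij) : bij_fun p =1 bij_fun q -> p = q.
Proof.
move=> /funext; case: p => f f' fK f'K; case: q => g g' gK g'K /= fg.
have f'g' : f' = g' by apply/funext => x; rewrite -[x in LHS]g'K -fg fK.
by subst g g'; congr SelfBij; exact: Prop_irrelevance.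
Qed.

Definition bij_one : self_bij := @SelfBij id id (fun=> erefl) (fun=> erefl).
(** [p] is applied before [q], as in the concatenation of paths; this makes right translation a
    homomorphism instead of an antihomomorphism. *)
Definition bij_mul (p q : self_bij) : self_bij :=
  SelfBij (can_comp (bij_funK q) (bij_funK p)) (can_comp (bij_invK p) (bij_invK q)).
Definition bij_invg (p : self_bij) : self_bij := SelfBij (bij_invK p) (bij_funK p).

Fact bij_mulA : associative bij_mul. Proof. by move=> p q r; exact: bijP. Qed.
Fact bij_mul1g : left_id bij_one bij_mul. Proof. by move=> p; exact: bijP. Qed.
Fact bij_mulg1 : right_id bij_one bij_mul. Proof. by move=> p; exact: bijP. Qed.
Fact bij_mulVg : left_inverse bij_one bij_invg bij_mul.
Proof. by move=> p; apply: bijP => x /=; exact: bij_invK. Qed.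
Fact bij_mulgV : right_inverse bij_one bij_invg bij_mul.
Proof. by move=> p; apply: bijP => x /=; exact: bij_funK. Qed.

HB.instance Definition _ :=
  isGroup.Build self_bij bij_mulA bij_mul1g bij_mulg1 bij_mulVg bij_mulgV.

End Bijections.

Definition right_mulg (G : groupType) (h : G) : self_bij G :=
  SelfBij (mulgK h) (mulgVK h).

Lemma right_mulgM (G : groupType) : {morph @right_mulg G : g h / (g * h)%g}.
Proof. by move=> g h; apply: bijP => x /=; rewrite mulgA. Qed.

Section Pi1Lift.
Context (R : realType) (T : topologicalType) (x0 : T) (M : groupType).
Local Notation I := (unit_interval R).
Context (m : (I -> T) -> M) (cm : cocycle m).

Definition pi1_lift (g : pi1 R x0) : M := m (repr g).

Lemma pi1_liftE (f : {path I from x0 to x0}) : pi1_lift (pi1_class f) = m f.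
Proof. by apply: (cocycle_homotopic cm); exact: repr_pi1_class. Qed.

Lemma pi1_liftM : {morph pi1_lift : g h / (g * h)%g}.
Proof.
move=> g h; rewrite [LHS]pi1_liftE (cocycle_half cm); last exact: cts_fun.
have E : concat (repr g) (repr h) = join_path (repr g) (repr h) :> (I -> T).
  by apply/funext => t; rewrite concatE.
by rewrite E lhalf_join_path rhalf_join_path // path_zero path_one.
Qed.

End Pi1Lift.

(** * Gluing handles along walls *)

Section Walls.
Context (R : realType) (n : nat) (Y B Z : topologicalType).
Local Notation I := (unit_interval R).
Local Notation one := classical_sets.one.
Context (j : Y -> B) (jinv : B -> Y) (P : 'I_n -> Z * R -> B).
Context (zc : 'I_n -> B -> Z) (rc : 'I_n -> B -> R) (forget : 'I_n -> Y -> Z).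
Local Notation W a := (range (P a)).

(* [B] is the union of the open set [j Y] and of disjoint open sets parametrized by
   the [P a]; the wall is at the parameter [0], and [jinv], [zc], [rc] are inverse
   charts, arbitrary outside the corresponding open sets. *)
Record walls : Prop := Walls {
  walls_j : continuous j;
  walls_jK : cancel j jinv;
  walls_jinv : forall b, range j b -> {for b, continuous jinv};
  walls_j_open : open (range j);
  walls_P : forall a, continuous (P a);
  walls_zcK : forall a z r, zc a (P a (z, r)) = z;
  walls_rcK : forall a z r, rc a (P a (z, r)) = r;
  walls_zc : forall a b, W a b -> {for b, continuous (zc a)};
  walls_rc : forall a b, W a b -> {for b, continuous (rc a)};
  walls_P_open : forall a, open (W a);
  walls_off : forall a z r, range j (P a (z, r)) <-> r != 0;
  walls_disj : forall a a' b, W a b -> W a' b -> a = a';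
  walls_cover : forall b, range j b \/ exists a, W a b;
  walls_forget : forall a, continuous (forget a);
  walls_forgetE : forall a y z r, j y = P a (z, r) -> forget a y = z }.

Hypothesis wP : walls.

Definition put a (z : Z) (r : R) : Y := jinv (P a (z, r)).

Lemma jinvK b : range j b -> j (jinv b) = b.
Proof. by move=> [y _ <-]; rewrite (walls_jK wP). Qed.

Lemma j_put a z r : r != 0 -> j (put a z r) = P a (z, r).
Proof. by move=> r0; rewrite jinvK //; apply/(walls_off wP). Qed.

Lemma forget_put a z r : r != 0 -> forget a (put a z r) = z.
Proof. by move=> r0; apply: (walls_forgetE wP (r := r)); rewrite j_put. Qed.

Lemma P_continuous (S : topologicalType) a (z : S -> Z) (r : S -> R) :
  continuous z -> continuous r -> continuous (fun s => P a (z s, r s)).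
Proof.
move=> cz cr s; apply: (@continuous_comp _ _ _ (fun s => (z s, r s)) (P a)).
  by apply: pair_continuous_at; [exact: cz|exact: cr].
exact: walls_P.
Qed.

Lemma jinv_continuous (S : topologicalType) (sigma : S -> B) :
  continuous sigma -> (forall s, range j (sigma s)) -> continuous (jinv \o sigma).
Proof.
by move=> cs js s; apply: continuous_comp; [exact: cs|exact: walls_jinv].
Qed.

Lemma put_continuous (S : topologicalType) a (z : S -> Z) (r : S -> R) :
  continuous z -> continuous r -> (forall s, r s != 0) ->
  continuous (fun s => put a (z s) (r s)).
Proof.
move=> cz cr r0; apply: (jinv_continuous (P_continuous (a := a) cz cr)) => s.
exact/(walls_off wP).
Qed.

Lemma zc_continuous (S : topologicalType) a (sigma : S -> B) :
  continuous sigma -> (forall s, W a (sigma s)) -> continuous (zc a \o sigma).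
Proof.
by move=> cs js s; apply: continuous_comp; [exact: cs|exact: walls_zc].
Qed.

Lemma rc_continuous (S : topologicalType) a (sigma : S -> B) :
  continuous sigma -> (forall s, W a (sigma s)) -> continuous (rc a \o sigma).
Proof.
by move=> cs js s; apply: continuous_comp; [exact: cs|exact: walls_rc].
Qed.

Lemma zrcK a b : W a b -> P a (zc a b, rc a b) = b.
Proof. by move=> [[z r] _ <-]; rewrite (walls_zcK wP) (walls_rcK wP). Qed.

Definition toward (r e : R) (t : I) : R := (1 - ival t) * r + ival t * e.

Lemma toward_continuous (S : topologicalType) (r : S -> R) (e : R) :
  continuous r -> continuous (fun st : S * I => toward (r st.1) e st.2).
Proof.
move=> cr st.
have c2 : {for st, continuous (fun st : S * I => ival st.2)}.
  by apply: (@continuous_comp _ _ _ snd (@ival R)); [exact: cvg_snd|exact: ival_continuous].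
have c1 : {for st, continuous (fun st : S * I => r st.1)}.
  by apply: (@continuous_comp _ _ _ fst r); [exact: cvg_fst|exact: cr].
apply: cvgD.
  by apply: cvgM => //; apply: cvgB => //; exact: cvg_cst.
by apply: cvgM => //; exact: cvg_cst.
Qed.

Lemma toward_continuous1 (r e : R) : continuous (toward r e).
Proof.
move=> t; have := @toward_continuous I (fun=> r) e (@cst_continuous _ _ r).
move=> /(@snd_slice_continuous R _ (fun st => toward r e st.2) zero); exact.
Qed.

Lemma toward0 r e : toward r e zero = r.
Proof. by rewrite /toward ival0; lra. Qed.

Lemma toward1 r e : toward r e one = e.
Proof. by rewrite /toward ival1; lra. Qed.

Lemma toward_id r t : toward r r t = r.
Proof. by rewrite /toward; lra. Qed.

Lemma toward_neq0 r e t : 0 < r * e -> toward r e t != 0.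
Proof.
move=> re; have t0 := ival_ge0 t; have t1 := ival_le1 t; rewrite /toward.
have r0 : r != 0 by apply: contraTneq re => ->; rewrite mul0r ltxx.
have h : 0 < r * ((1 - ival t) * r + ival t * e).
  rewrite mulrDr !(mulrCA r).
  have rr : 0 < r * r by rewrite -expr2 exprn_even_gt0.
  by case: (ltP (ival t) 1) => t2; nra.
by apply: contraTneq h => ->; rewrite mulr0 ltxx.
Qed.

Definition cross a z (t : I) : B := P a (z, toward (-1) 1 t).

Lemma cross_continuous a z : continuous (cross a z).
Proof.
by apply: P_continuous; [exact: cst_continuous|exact: toward_continuous1].
Qed.

(** By the intermediate value theorem. Along a path off the wall the discontinuous function [side]
    is therefore constant. *)
Lemma same_side (r : I -> R) : continuous r -> (forall t, r t != 0) ->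
  forall t, 0 < r t * r zero.
Proof.
move=> cr r0 t; rewrite lt_neqAle eq_sym mulf_neq0 //=.
rewrite leNgt; apply/negP => rt.
have cf : {within `[0, ival t], continuous (fun x => r (clamp x))}.
  apply: continuous_subspaceT => x; apply: continuous_comp; last exact: cr.
  exact: clamp_continuous.
have := @IVT R _ 0 (ival t) 0 (ival_ge0 t) cf.
rewrite ivalK clamp0; case=> [|x _ /eqP]; last by rewrite (negbTE (r0 _)).
by rewrite /Order.min /Order.max; case: ifP => h; apply/andP; split; nra.
Qed.

(** The square swept out when the whole path is moved linearly to the level [e] of the handle. *)
Lemma cocycle_slide_P (M : groupType) (L : (I -> B) -> M) a (z : I -> Z)
    (r : I -> R) e : cocycle L -> continuous z -> continuous r ->
  (L (fun t => P a (z t, r t)) * L (fun t => P a (z one, toward (r one) e t)) =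
   L (fun t => P a (z zero, toward (r zero) e t)) * L (fun t => P a (z t, e)))%g.
Proof.
move=> cL cz cr.
pose Q (st : I * I) := P a (z st.1, toward (r st.1) e st.2).
have cQ : continuous Q.
  apply: P_continuous; last exact: toward_continuous.
  by move=> st; apply: continuous_comp; [exact: cvg_fst|exact: cz].
have := cocycle_sq cL cQ; rewrite /Q /=.
under eq_fun do rewrite toward0.
by under [X in _ = (_ * L X)%g]eq_fun do rewrite toward1.
Qed.

Lemma cocycle_slide_put (M : groupType) (L : (I -> Y) -> M) a (z : I -> Z)
    (r : I -> R) e : cocycle L -> continuous z -> continuous r ->
  (forall t, 0 < r t * e) ->
  (L (fun t => put a (z t) (r t)) * L (fun t => put a (z one) (toward (r one) e t)) =
   L (fun t => put a (z zero) (toward (r zero) e t)) * L (fun t => put a (z t) e))%g.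
Proof.
move=> cL cz cr re.
pose Q (st : I * I) := put a (z st.1) (toward (r st.1) e st.2).
have cQ : continuous Q.
  apply: put_continuous; last by move=> st; exact: toward_neq0.
    by move=> st; apply: continuous_comp; [exact: cvg_fst|exact: cz].
  exact: toward_continuous.
have := cocycle_sq cL cQ; rewrite /Q /=.
under eq_fun do rewrite toward0.
by under [X in _ = (_ * L X)%g]eq_fun do rewrite toward1.
Qed.

(** * Extending a cocycle from the complement of the walls *)

Section Extension.
Context (M : groupType) (L : (I -> Y) -> M) (cL : cocycle L) (theta : 'I_n -> Z -> M).
(** The HNN relation in groupoid form: [theta a z] is the value of the crossing at [z], and it
    intertwines the motion [zeta] performed on the two sides. *)
Hypothesis thetaP : forall a (zeta : I -> Z), continuous zeta ->
  (L (fun t => put a (zeta t) (-1)%R) * theta a (zeta one) =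
   theta a (zeta zero) * L (fun t => put a (zeta t) 1%R))%g.

Definition side (r : R) : R := if r < 0 then -1 else 1.

(* Trivializes the extension over a handle by sliding to the positive side. For
   [rc a b = 0] the slide may be discontinuous, so that [push] is an arbitrary group
   element there; this is harmless. *)
Definition push a b : M :=
  let v := L (fun t => put a (zc a b) (toward (rc a b) (side (rc a b)) t)) in
  (if rc a b < 0 then v * theta a (zc a b) else v)%g.

Definition local_cocycle (i : option 'I_n) (sigma : I -> B) : M :=
  if i is Some a then
    (push a (sigma zero) * L (fun t => put a (zc a (sigma t)) 1) *
     (push a (sigma one))^-1)%g
  else L (jinv \o sigma).

(** Off the wall the path keeps its side, so it can be slid within [Y] to level [1] or [-1]; from
    level [-1], [thetaP] carries it over to level [1]. *)
Lemma local_cocycle_agree a sigma : continuous sigma ->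
  (forall t, range j (sigma t)) -> (forall t, W a (sigma t)) ->
  local_cocycle None sigma = local_cocycle (Some a) sigma.
Proof.
move=> cs js Ws; pose z := zc a \o sigma; pose r := rc a \o sigma.
have cz : continuous z by exact: zc_continuous.
have cr : continuous r by exact: rc_continuous.
have sE t : sigma t = P a (z t, r t) by rewrite zrcK.
have r0 t : r t != 0 by apply/(walls_off wP a (z t)); rewrite -sE.
have rr := same_side cr r0.
have re t : 0 < r t * side (r zero).
  by have := rr t; have := rr zero; rewrite /side; case: ifP => h;
    have := r0 zero; rewrite neq_lt => /orP[] ? ? ?; nra.
have sideE : side (r one) = side (r zero).
  by have := re one; rewrite /side; do 2 case: ifP => ?; nra.
have neg1 : (r one < 0) = (r zero < 0).
  by have := sideE; rewrite /side; do 2 case: ifP => ? //; lra.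
have sl := cocycle_slide_put a cL cz cr re.
have -> : local_cocycle None sigma = L (fun t => put a (z t) (r t)).
  by congr L; apply/funext => t; rewrite /put -sE.
have lE : L (fun t => put a (z t) (r t)) = _ := canRL (mulgK _) sl.
rewrite lE /local_cocycle /push -/(z zero) -/(r zero) -/(z one) -/(r one) sideE neg1.
rewrite /side; case: ifP => [_|_] //.
by rewrite (canRL (mulgK _) (thetaP a cz)) invgM !mulgA.
Qed.

(** The mapping property of the glued space. Both embeddings come from it, by different choices of
    [M], [L] and [theta]. *)
Lemma extend_over_walls : exists m : (I -> B) -> M, [/\ cocycle m,
  forall sigma, continuous sigma -> m (j \o sigma) = L sigma &
  forall a z, m (cross a z) = theta a z].
Proof.
pose U i := if i is Some a then W a else range j.
have cput a (S : topologicalType) (sigma : S -> B) : continuous sigma ->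
    (forall t, W a (sigma t)) -> continuous (fun t => put a (zc a (sigma t)) 1).
  move=> cs Us; apply: put_continuous => [||t]; last exact: oner_neq0.
    exact: (zc_continuous cs Us).
  exact: cst_continuous.
have [||||||m [cm mE]] := @extend_cocycle R B M (option 'I_n) U local_cocycle.
- by case=> [a|]; [exact: walls_P_open|exact: walls_j_open].
- by move=> b; have [jb|[a Wb]] := walls_cover wP b; [exists None|exists (Some a)].
- case=> [a|] [a'|] sigma cs Us Us' //.
  + by rewrite (walls_disj wP (Us zero) (Us' zero)).
  + exact/esym/local_cocycle_agree.
  + exact: local_cocycle_agree.
- case=> [a|] sigma cs Us /=; last first.
    by rewrite (cocycle_half cL) //; exact: jinv_continuous.
  rewrite (cocycle_half cL); last exact: cput.
  by rewrite lhalf0 rhalf1 lhalf1 -!mulgA mulKg.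
- case=> [a|] b Ub /=; last exact: (cocycle_cst cL).
  by rewrite (cocycle_cst cL) mulg1 mulgV.
- case=> [a|] Q cQ UQ /=; last exact: (cocycle_sq cL (jinv_continuous cQ UQ)).
  have := cocycle_sq cL (cput a _ _ cQ UQ) => sq.
  by rewrite -!mulgA !mulKg !mulgA -(mulgA (push _ _)) sq mulgA.
exists m; split => // [sigma cs|a z].
  rewrite (mE None).
  - by congr L; apply/funext => t /=; rewrite (walls_jK wP).
  - by move=> t; apply: continuous_comp; [exact: cs|exact: walls_j].
  - by move=> t; exists (sigma t).
rewrite (mE (Some a)); [|exact: cross_continuous|by move=> t; exists (z, toward (-1) 1 t)].
(* The crossing ends at the levels [-1] and [1], where the slides are constant; only the factor
   [theta a z] at its start survives. *)
rewrite /= /push /cross !(walls_rcK wP) !(walls_zcK wP) toward0 toward1.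
rewrite /side ltrN10 ltr10.
under eq_fun do rewrite toward_id.
under [X in (_ * L X * _)%g]eq_fun do rewrite (walls_zcK wP).
under [X in (_ * (L X)^-1)%g]eq_fun do rewrite toward_id.
by rewrite !(cocycle_cst cL) mul1g mulg1 invg1 mulg1.
Qed.

End Extension.


Section Reachable.
Context (y0 : Y).
Hypotheses (Y_conn : forall a b : Y, reachable R a b)
           (Z_conn : forall a b : Z, reachable R a b).
Local Notation G := (pi1 R y0).

Lemma j_comp_continuous (S : topologicalType) (sigma : S -> Y) :
  continuous sigma -> continuous (j \o sigma).
Proof. by move=> cs t; apply: continuous_comp; [exact: cs|exact: walls_j]. Qed.

Lemma B_reachable b : reachable R (j y0) b.
Proof.
have base y : reachable R (j y0) (j y).
  have [s [cs s0 s1]] := Y_conn y0 y.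
  by exists (j \o s); rewrite /= s0 s1; split => //; exact: j_comp_continuous.
have [[y _ <-] //|[a [[z r] _ <-]]] := walls_cover wP b.
have [s [cs s0 s1]] := base (put a z 1).
have cP : continuous (fun t => P a (z, toward 1 r t)).
  by apply: P_continuous; [exact: cst_continuous|exact: toward_continuous1].
have E : s one = P a (z, toward 1 r zero).
  by rewrite toward0 s1 j_put ?oner_neq0.
exists (join_path s (fun t => P a (z, toward 1 r t))).
rewrite join_path0 join_path1 toward1; split => //.
exact: join_path_continuous.
Qed.

(** * The right regular action of [G], extended to the paths of [B] *)

Section BaseCocycle.
Context (E : (I -> Y) -> G) (cE : cocycle E).
Hypothesis E_loop : forall f : {path I from y0 to y0}, E f = pi1_class f.

Lemma path_with_class b b' (g : G) : exists sigma : I -> Y,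
  [/\ continuous sigma, sigma zero = b, sigma one = b' & E sigma = g].
Proof.
have [p [cp p0 p1]] := Y_conn y0 b; have [q [cq q0 q1]] := Y_conn y0 b'.
pose f : {path I from y0 to y0} := repr (E p * g * (E q)^-1)%g.
have cf : continuous f by exact: cts_fun.
have f0 : f zero = y0 by exact: path_zero.
have f1 : f one = y0 by exact: path_one.
have fE : E f = (E p * g * (E q)^-1)%g by rewrite E_loop pi1_classK.
have cfp := flip_path_continuous cp.
have h1 : flip_path p one = f zero by rewrite flip_path1 p0 f0.
have h2 : join_path (flip_path p) f one = q zero by rewrite join_path1 f1 q0.
have c1 := join_path_continuous cfp cf h1.
exists (join_path (join_path (flip_path p) f) q); split.
- exact: join_path_continuous.
- by rewrite !join_path0 flip_path0.
- by rewrite join_path1.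
- by rewrite !(cocycle_cat cE) // (cocycle_rev cE) // fE -!mulgA mulKg mulVg mulg1.
Qed.

(** A pair [(g, b)] is a point of the universal cover: the paths from [y0] to [b] with value [g]
    form one homotopy class, as [E] detects trivial loops. Hence the value of [A] on such a path
    depends on the pair only, and [al] is this function. *)
Lemma cocycle_of_class (M : groupType) (A : (I -> Y) -> M) : cocycle A ->
  exists al : G -> Y -> M, al 1%g y0 = 1%g /\ forall g sigma, continuous sigma ->
    al (g * E sigma)%g (sigma one) = (al g (sigma zero) * A sigma)%g.
Proof.
move=> cA.
have trivial_loop s : continuous s -> s zero = y0 -> s one = y0 -> E s = 1%g ->
    A s = 1%g.
  move=> cs s0 s1; have [f fE] := path_ends cs s0 s1; rewrite -fE E_loop.
  rewrite (_ : 1%g = pi1_class (const_path R y0)) // => /pi1_classP.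
  by move=> /(cocycle_homotopic cA) ->; exact: (cocycle_cst cA).
have uniq s s' : continuous s -> continuous s' -> s zero = y0 -> s' zero = y0 ->
    s one = s' one -> E s = E s' -> A s = A s'.
  move=> cs cs' s0 s0' s1 ss'; apply: (mulIg (A s')^-1%g).
  rewrite mulgV -(cocycle_rev cA) // -(cocycle_cat cA) ?flip_path0 //;
    last exact: flip_path_continuous.
  apply: trivial_loop.
  - by apply: join_path_continuous; rewrite ?flip_path0 //; exact: flip_path_continuous.
  - by rewrite join_path0.
  - by rewrite join_path1 flip_path1.
  - rewrite (cocycle_cat cE) ?flip_path0 //; last exact: flip_path_continuous.
    by rewrite (cocycle_rev cE) // ss' mulgV.
have chosen (gb : G * Y) : exists s : I -> Y,
    [/\ continuous s, s zero = y0, s one = gb.2 & E s = gb.1].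
  exact: path_with_class.
have /boolp.choice[p pP] := chosen.
exists (fun g b => A (p (g, b))); split.
  by have [? ? ? ?] := pP (1%g, y0); exact: trivial_loop.
move=> g s cs; have [c1 z1 o1 e1] := pP (g, s zero).
have [c2 z2 o2 e2] := pP (g * E s, s one)%g.
rewrite -(cocycle_cat cA) //; apply: uniq => //.
- exact: join_path_continuous.
- by rewrite join_path0.
- by rewrite join_path1.
- by rewrite (cocycle_cat cE) // e1 e2.
Qed.

(** On loops this is, up to a change of base point, the retraction of [G] onto the motions during
    which the [a]-th point waits next to [x]. *)
Lemma put_forget_cocycle a e : e != 0 ->
  cocycle (fun sigma => E (fun t => put a (forget a (sigma t)) e)).
Proof.
move=> e0; apply: (@cocycle_comp R Y Y (fun y => put a (forget a y) e)) => //.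
apply: put_continuous => //; [exact: walls_forget|exact: cst_continuous].
Qed.

Section Swap.
Context (a : 'I_n).
Local Notation A e sigma := (E (fun t => put a (forget a (sigma t)) e)).
Context (al : R -> G -> Y -> G).
Hypothesis al1 : forall e, e != 0 -> al e 1%g y0 = 1%g.
Hypothesis alE : forall e, e != 0 -> forall g sigma, continuous sigma ->
  al e (g * E sigma)%g (sigma one) = (al e g (sigma zero) * A e sigma)%g.

(* If [g] is the class of a path [gamma] from [y0] to [put a z e1], this is the class
   of the path that follows [gamma], then brings the other points back along [gamma]
   with the [a]-th point kept next to [x] on the side [e1], passes to the side [e2]
   by a path of class [k], and returns along [gamma] with the [a]-th point kept on
   the side [e2]. *)
Definition swap e1 e2 (k : G) (z : Z) (g : G) : G :=
  (g * (al e1 g (put a z e1))^-1 * k * al e2 g (put a z e1))%g.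

Lemma put_path_continuous e (s : I -> Y) : e != 0 -> continuous s ->
  continuous (fun t => put a (forget a (s t)) e).
Proof.
move=> e0 cs; apply: put_continuous => //; last exact: cst_continuous.
by move=> t; apply: continuous_comp; [exact: cs|exact: walls_forget].
Qed.

(** [swap] is the value of an actual path: [s], then [p1] reversed, then [c], then [p2]. As [forget]
    undoes [put], the paths [s], [p1] and [p2] have the same value under [A e]; the first two cancel
    and leave the values of [c] and [p2]. *)
Lemma al_swap e1 e2 e z g (c : I -> Y) : e1 != 0 -> e2 != 0 -> e != 0 ->
  continuous c -> c zero = put a (forget a y0) e1 ->
  c one = put a (forget a y0) e2 ->
  al e (swap e1 e2 (E c) z g) (put a z e2) = (A e c * al e g (put a z e1))%g.
Proof.
move=> h1 h2 h cc c0 c1.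
have [s [cs s0 s1 sE]] := path_with_class y0 (put a z e1) g.
have alA d : d != 0 -> al d g (put a z e1) = A d s.
  by move=> d0; rewrite -sE -s1 -[E s]mul1g alE // s0 al1 // mul1g.
rewrite /swap !alA //.
pose p1 t := put a (forget a (s t)) e1; pose p2 t := put a (forget a (s t)) e2.
have cp1 : continuous p1 by exact: put_path_continuous.
have cp2 : continuous p2 by exact: put_path_continuous.
have cf1 := flip_path_continuous cp1.
have e20 : p2 zero = c one by rewrite /p2 s0 c1.
have ec0 : c zero = flip_path p1 one by rewrite flip_path1 /p1 s0 c0.
have ef0 : flip_path p1 zero = put a z e1 by rewrite flip_path0 /p1 s1 forget_put.
transitivity (al e (g * E (flip_path p1) * E c * E p2)%g (p2 one)).
  by rewrite (cocycle_rev cE) // /p2 s1 forget_put.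
rewrite (alE h _ cp2) e20 (alE h _ cc) ec0 (alE h _ cf1) ef0 alA //.
rewrite (cocycle_rev (put_forget_cocycle a h) cp1) /p1 /p2 /=.
under [X in (_ * (E X)^-1 * _ * _)%g]eq_fun do rewrite forget_put //.
under [X in (_ * _ * _ * E X)%g]eq_fun do rewrite forget_put //.
by rewrite mulgV mul1g.
Qed.

(** By [al_swap] the values of [al] at the image are known up to the factors [A e1 c] and [A e2 c],
    present because [c] may move the other points; [k] is what must be inserted to cancel
    everything. *)
Lemma swap_cancel e1 e2 z (c : I -> Y) k : e1 != 0 -> e2 != 0 ->
  continuous c -> c zero = put a (forget a y0) e1 ->
  c one = put a (forget a y0) e2 ->
  k = (A e2 c * (E c)^-1 * (A e1 c)^-1)%g ->
  cancel (swap e1 e2 (E c) z) (swap e2 e1 k z).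
Proof.
move=> h1 h2 cc c0 c1 kE g.
rewrite {1}/swap !(al_swap z g h1 h2 _ cc c0 c1) // {1}/swap kE.
by rewrite invgM -!mulgA !(mulKg, mulVKg) mulVg mulg1.
Qed.

(** Appending the motion multiplies [al e1] and [al e2] on the right by its values on the two sides.
    The first of these cancels against the appended factor, the second comes out on the right. *)
Lemma swap_intertwine e1 e2 k (zeta : I -> Z) g : e1 != 0 -> e2 != 0 ->
  continuous zeta ->
  swap e1 e2 k (zeta one) (g * E (fun t => put a (zeta t) e1))%g =
  (swap e1 e2 k (zeta zero) g * E (fun t => put a (zeta t) e2))%g.
Proof.
move=> h1 h2 cz; rewrite /swap.
have cp : continuous (fun t => put a (zeta t) e1).
  by apply: put_continuous => //; exact: cst_continuous.
have alp e : e != 0 -> al e (g * E (fun t => put a (zeta t) e1))%g (put a (zeta one) e1) =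
    (al e g (put a (zeta zero) e1) * E (fun t => put a (zeta t) e))%g.
  move=> h; rewrite (alE h g cp); congr (_ * E _)%g; apply/funext => t.
  by rewrite forget_put.
by rewrite !alp // invgM -!mulgA mulVKg.
Qed.

Lemma swap_exists : exists theta : Z -> self_bij G, forall zeta : I -> Z,
  continuous zeta ->
  (right_mulg (E (fun t => put a (zeta t) (-1)%R)) * theta (zeta one) =
   theta (zeta zero) * right_mulg (E (fun t => put a (zeta t) 1%R)))%g.
Proof.
have h1 : -1 != 0 :> R by rewrite oppr_eq0 oner_eq0.
have h2 : 1 != 0 :> R by rewrite oner_eq0.
have [c [cc c0 c1]] := Y_conn (put a (forget a y0) (-1)) (put a (forget a y0) 1).
pose p e t := put a (forget a (c t)) e.
have cp e : e != 0 -> continuous (p e) by move=> h; exact: put_path_continuous.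
have p0 e : p e zero = put a (forget a y0) e by rewrite /p c0 forget_put.
have p1 e : p e one = put a (forget a y0) e by rewrite /p c1 forget_put.
(* A path with the value [k] required by [swap_cancel], as [p e] has the value [A e c]. Since [k]
   comes from a path, that lemma also applies with the two sides exchanged. *)
pose c' := join_path (join_path (p 1) (flip_path c)) (flip_path (p (-1))).
have cfc := flip_path_continuous cc.
have cfp := flip_path_continuous (cp _ h1).
have j1 : p 1 one = flip_path c zero by rewrite p1 flip_path0 c1.
have j2 : join_path (p 1) (flip_path c) one = flip_path (p (-1)) zero.
  by rewrite join_path1 flip_path0 flip_path1 p1 c0.
have cj := join_path_continuous (cp _ h2) cfc j1.
have cc' : continuous c' by exact: join_path_continuous.
have coc (L : (I -> Y) -> G) : cocycle L ->
    L c' = (L (p 1%R) * (L c)^-1 * (L (p (-1)%R))^-1)%g.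
  by move=> cL; rewrite /c' !(cocycle_cat cL) ?(cocycle_rev cL) //; exact: cp.
have Ec' : E c' = (A 1%R c * (E c)^-1 * (A (-1)%R c)^-1)%g := coc _ cE.
have Ac' e : e != 0 -> A e c' = (A e c)^-1%g.
  move=> he; rewrite (coc _ (put_forget_cocycle a he)) /p.
  under [X in (E X * _ * _)%g]eq_fun do rewrite forget_put //.
  under [X in (_ * _ * (E X)^-1)%g]eq_fun do rewrite forget_put //.
  by rewrite mulgV mul1g.
have K1 z : cancel (swap (-1) 1 (E c) z) (swap 1 (-1) (E c') z).
  exact: swap_cancel.
have K2 z : cancel (swap 1 (-1) (E c') z) (swap (-1) 1 (E c) z).
  apply: swap_cancel => //.
  - by rewrite /c' !join_path0 p0.
  - by rewrite /c' join_path1 flip_path1 p0.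
  - by rewrite !Ac' // Ec' invgK !invgM !invgK -!mulgA !(mulKg, mulVKg) mulVg mulg1.
exists (fun z => SelfBij (K1 z) (K2 z)) => zeta cz; apply: bijP => g /=.
exact: swap_intertwine.
Qed.

End Swap.
Lemma base_monodromy : exists m : (I -> B) -> self_bij G, cocycle m /\
  forall sigma, continuous sigma -> m (j \o sigma) = right_mulg (E sigma).
Proof.
have swaps a : exists theta : Z -> self_bij G, forall zeta : I -> Z,
    continuous zeta ->
    (right_mulg (E (fun t => put a (zeta t) (-1)%R)) * theta (zeta one) =
     theta (zeta zero) * right_mulg (E (fun t => put a (zeta t) 1%R)))%g.
  have als e : exists al : G -> Y -> G, e != 0 -> al 1%g y0 = 1%g /\
      forall g sigma, continuous sigma -> al (g * E sigma)%g (sigma one) =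
        (al g (sigma zero) * E (fun t => put a (forget a (sigma t)) e))%g.
    (* The choice below ranges over all levels; at the wall itself any function will do. *)
    have [->|e0] := eqVneq e 0; first by exists (fun _ _ => 1%g).
    by have [al alP] := cocycle_of_class (put_forget_cocycle a e0); exists al.
  have /boolp.choice[al alP] := als.
  by apply: (@swap_exists a al) => e /alP[].
have /boolp.choice[theta thetaP] := swaps.
have cL : cocycle (@right_mulg G \o E) by apply: cocycle_morph => //; exact: right_mulgM.
have [m [cm mj _]] := extend_over_walls cL thetaP.
by exists m.
Qed.

End BaseCocycle.

(** * Generators of the fundamental group of [B] *)

Section Generation.
Context (E : (I -> B) -> pi1 R (j y0)) (cE : cocycle E).
Hypothesis E_loop : forall f : {path I from j y0 to j y0}, E f = pi1_class f.
Context (gam : Y -> I -> Y).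
Hypothesis gamP : forall y,
  [/\ continuous (gam y), gam y zero = y0 & gam y one = y].
Context (H : pi1 R (j y0) -> Prop).
Hypotheses (H1 : H 1%g) (HM : forall g h, H g -> H h -> H (g * h)%g)
  (HV : forall g, H g -> H g^-1%g).
Hypothesis H_j : forall f : {path I from y0 to y0}, H (E (j \o f)).
Hypothesis H_cross : forall a, exists z,
  H (E (j \o gam (put a z (-1))) * E (cross a z) *
     (E (j \o gam (put a z 1)))^-1)%g.

Local Notation hY y := (E (j \o gam y)).

Lemma Ej_cocycle : cocycle (fun sigma => E (j \o sigma)).
Proof. by apply: cocycle_comp => //; exact: walls_j. Qed.

Lemma generation_off sigma : continuous sigma ->
  H (hY (sigma zero) * E (j \o sigma) * (hY (sigma one))^-1)%g.
Proof.
move=> cs; have [c0 z0 o0] := gamP (sigma zero); have [c1 z1 o1] := gamP (sigma one).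
have j1 := join_path_continuous c0 cs o0.
have cf := flip_path_continuous c1.
have e2 : join_path (gam (sigma zero)) sigma one = flip_path (gam (sigma one)) zero.
  by rewrite join_path1 flip_path0 o1.
have [||f fE] := path_ends (a := y0) (b := y0) (join_path_continuous j1 cf e2).
- by rewrite !join_path0.
- by rewrite join_path1 flip_path1.
have := H_j f; rewrite fE.
by rewrite !(cocycle_cat Ej_cocycle) ?(cocycle_rev Ej_cocycle).
Qed.

(** One crossing per wall suffices: the square over a path from [z] to [z0] in [Z] expresses the
    crossing at [z] by the one at [z0] and two motions off the wall. *)
Lemma generation_cross a z :
  H (hY (put a z (-1)) * E (cross a z) * (hY (put a z 1))^-1)%g.
Proof.
have h1 : -1 != 0 :> R by rewrite oppr_eq0 oner_eq0.
have h2 : 1 != 0 :> R by rewrite oner_eq0.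
have [z0 Hz0] := H_cross a; have [zeta [cz zeta0 zeta1]] := Z_conn z z0.
have cput e : e != 0 -> continuous (fun t => put a (zeta t) e).
  by move=> e0; apply: put_continuous => //; exact: cst_continuous.
have := cocycle_slide_P a 1 cE cz (@cst_continuous I R (-1)).
rewrite zeta0 zeta1 -[E (fun t => P a (z0, _))]/(E (cross a z0)).
rewrite -[E (fun t => P a (z, _))]/(E (cross a z)).
rewrite (_ : (fun t => P a (zeta t, -1)) = j \o (fun t => put a (zeta t) (-1))); last first.
  by apply/funext => t /=; rewrite j_put.
rewrite (_ : (fun t => P a (zeta t, 1)) = j \o (fun t => put a (zeta t) 1)); last first.
  by apply/funext => t /=; rewrite j_put.
move=> /esym /(canRL (mulgK _)) ->.
have := HM (HM (generation_off (cput _ h1)) Hz0) (HV (generation_off (cput _ h2))).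
rewrite zeta0 zeta1 !invgM !invgK -!mulgA mulKg mulKg.
by rewrite !mulgA.
Qed.

Local Notation slide a b := (fun t => P a (zc a b, toward (rc a b) 1 t)).

(** [gam] reaches only points off the walls, while bisection may cut a path on a wall. There the
    tail goes to level [1] along [gam] and then back along the slide; the second property says that
    modulo [H] all tails on a handle have this form. *)
Lemma wall_tails : exists h : B -> pi1 R (j y0), (forall y, h (j y) = hY y) /\
  forall a b, W a b -> H (h b * E (slide a b) * (hY (put a (zc a b) 1))^-1)%g.
Proof.
have h1 : -1 != 0 :> R by rewrite oppr_eq0 oner_eq0.
have h2 : 1 != 0 :> R by rewrite oner_eq0.
suff hb b : exists hb : pi1 R (j y0), (forall y, j y = b -> hb = hY y) /\
    forall a, W a b -> H (hb * E (slide a b) * (hY (put a (zc a b) 1))^-1)%g.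
  have /boolp.choice[h hP] := hb; exists h; split; last by move=> a b; apply: (hP b).2.
  by move=> y; exact: (hP (j y)).1.
have [jb|njb] := pselect (range j b); last first.
  have [//|[a Wa]] := walls_cover wP b.
  exists (hY (put a (zc a b) 1) * (E (slide a b))^-1)%g; split.
    by move=> y yb; case: njb; exists y.
  by move=> a' /(walls_disj wP Wa) <-; rewrite mulgVK mulgV.
have [y _ yb] := jb; exists (hY y); split.
  by move=> y' y'b; rewrite -(walls_jK wP y) -(walls_jK wP y') yb y'b.
move=> a Wa; set z := zc a b; set r := rc a b.
have bE : b = P a (z, r) by rewrite zrcK.
have r0 : r != 0 by apply/(walls_off wP a z); rewrite -bE.
have yE : y = put a z r by rewrite /put -bE -yb (walls_jK wP).
have off e : 0 < r * e -> H (hY y * E (fun t => P a (z, toward r e t)) *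
    (hY (put a z e))^-1)%g.
  move=> re; pose s t := put a z (toward r e t).
  have cs : continuous s.
    apply: put_continuous; [exact: cst_continuous|exact: toward_continuous1|].
    by move=> t; exact: toward_neq0.
  have := generation_off cs; rewrite {1 3}/s toward0 toward1 -yE.
  congr (H (_ * E _ * _)%g); apply/funext => t /=.
  by rewrite j_put //; exact: toward_neq0.
have [rpos|rneg] := ltP 0 r; first by apply: off; rewrite mulr1.
have {}rneg : 0 < r * -1 by rewrite mulrN1 oppr_gt0 lt_neqAle r0.
(* From the negative side, the slide to [1] is a slide to [-1], off the wall, followed by a full
   crossing. *)
have := cocycle_slide_P a 1 cE (@cst_continuous I Z z) (@toward_continuous1 r (-1)).
rewrite (cocycle_cst cE) mulg1 toward0 toward1 => <-.
have := HM (off _ rneg) (generation_cross a z).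
by rewrite !mulgA mulgVK.
Qed.

(** Once paths are closed up by the tails [h], membership in [H] passes from the halves to the
    whole, so only paths inside [j Y] or inside one handle remain. *)
Lemma generation f : H (pi1_class (R := R) (x := j y0) f).
Proof.
have [h [hj hW]] := wall_tails.
pose U i := if i is Some a then W a else range j.
have U_open i : open (U i) by case: i => [a|]; [exact: walls_P_open|exact: walls_j_open].
have U_cover b : exists i, U i b.
  by have [jb|[a Wb]] := walls_cover wP b; [exists None|exists (Some a)].
have pind := path_ind U_open U_cover
  (P := fun s => H (h (s zero) * E s * (h (s one))^-1)%g).
have all_H : forall sigma, continuous sigma ->
    H (h (sigma zero) * E sigma * (h (sigma one))^-1)%g.
  apply: pind => [sigma [a|] cs Us|sigma cs IHl IHr].
  - have cz : continuous (zc a \o sigma) by exact: zc_continuous.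
    have cr : continuous (rc a \o sigma) by exact: rc_continuous.
    have := cocycle_slide_P a 1 cE cz cr.
    rewrite (_ : (fun t => P a ((zc a \o sigma) t, (rc a \o sigma) t)) = sigma); last first.
      by apply/funext => t /=; rewrite zrcK //; exact: Us.
    have h2 : 1 != 0 :> R by rewrite oner_eq0.
    have cp : continuous (fun t => put a (zc a (sigma t)) 1).
      by apply: put_continuous => //; exact: cst_continuous.
    rewrite (_ : (fun t => P a ((zc a \o sigma) t, 1)) =
      j \o (fun t => put a (zc a (sigma t)) 1)); last first.
      by apply/funext => t /=; rewrite j_put.
    move=> /(canRL (mulgK _)) ->.
    have := HM (HM (hW _ _ (Us zero)) (generation_off cp)) (HV (hW _ _ (Us one))).
    by rewrite !invgM !invgK -!mulgA !mulKg.
  - pose s := jinv \o sigma.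
    have cs' : continuous s by exact: jinv_continuous.
    have sE t : sigma t = j (s t) by rewrite /s /= jinvK //; exact: Us.
    have := generation_off cs'; rewrite -!hj -!sE.
    by congr (H (_ * E _ * _)%g); apply/funext => t /=; rewrite -sE.
  - have := HM IHl IHr; rewrite lhalf0 lhalf1 rhalf1 -!mulgA mulKg.
    by rewrite (cocycle_half cE cs) -!mulgA.
have cf : continuous f by exact: cts_fun.
have Hy0 : H (h (j y0)).
  rewrite hj; have [c z o] := gamP y0.
  by have [g gE] := path_ends c z o; rewrite -gE.
have := HM (HM (HV Hy0) (all_H f cf)) Hy0.
by rewrite path_zero path_one -!mulgA mulVg mulg1 mulKg E_loop.
Qed.

End Generation.

Lemma pi1_walls : exists f : {multiplicative
    free_product (pi1 R y0) (free_group n) -> pi1 R (j y0)},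
  [/\ range f = [set: _], injective (f \o free_product_inl) &
      injective (f \o free_product_inr)].
Proof.
have [EY [cEY EYl]] := loop_cocycle_exists (Y_conn y0).
have [E [cE El]] := loop_cocycle_exists B_reachable.
have gams y : exists s : I -> Y, [/\ continuous s, s zero = y0 & s one = y] by exact: Y_conn.
have /boolp.choice[gam gamP] := gams.
have cgam y : continuous (gam y) by have [] := gamP y.
have cjgam y : continuous (j \o gam y) by exact: j_comp_continuous.
pose z a := forget a y0.
have h1 : -1 != 0 :> R by rewrite oppr_eq0 oner_eq0.
have h2 : 1 != 0 :> R by rewrite oner_eq0.
have cEj := Ej_cocycle cE.
pose ell a := join_path (join_path (j \o gam (put a (z a) (-1))) (cross a (z a)))
  (flip_path (j \o gam (put a (z a) 1))).
have e1 a : (j \o gam (put a (z a) (-1))) one = cross a (z a) zero.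
  by have [_ _ /= ->] := gamP (put a (z a) (-1)); rewrite /cross toward0 j_put.
have e2 a : join_path (j \o gam (put a (z a) (-1))) (cross a (z a)) one =
    flip_path (j \o gam (put a (z a) 1)) zero.
  rewrite join_path1 flip_path0 /=.
  by have [_ _ ->] := gamP (put a (z a) 1); rewrite /cross toward1 j_put.
have c1 a := join_path_continuous (cjgam _) (@cross_continuous a (z a)) (e1 a).
have cf a : continuous (flip_path (j \o gam (put a (z a) 1))) by exact: flip_path_continuous.
have cell a : continuous (ell a) by exact: join_path_continuous.
have ellE (M : groupType) (L : (I -> B) -> M) : cocycle L -> forall a, L (ell a) =
    (L (j \o gam (put a (z a) (-1)%R)) * L (cross a (z a)) *
     (L (j \o gam (put a (z a) 1%R)))^-1)%g.
  move=> cL a; rewrite !(cocycle_cat cL) ?(cocycle_rev cL) //; exact: cross_continuous.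
have ells a : exists f : {path I from j y0 to j y0}, f = ell a :> (I -> B).
  apply: path_ends => //.
  - by rewrite /ell !join_path0 /=; have [_ -> _] := gamP (put a (z a) (-1)).
  - by rewrite /ell join_path1 flip_path1 /=; have [_ -> _] := gamP (put a (z a) 1).
pose phi := pi1_lift (x0 := y0) (fun sigma => E (j \o sigma)).
have phiM : {morph phi : a b / (a * b)%g} by exact: pi1_liftM.
pose t a := E (ell a).
pose F0 := free_product_lift phi t.
have F0M : {morph F0 : a b / (a * b)%g} by exact: free_product_liftM.
pose F : {multiplicative free_product (pi1 R y0) (free_group n) -> pi1 R (j y0)} :=
  HB.pack F0 (isMultiplicative.Build _ _ F0 F0M).
have Finl a : F (free_product_inl a) = phi a by exact: free_product_lift_inl.
have Finr b : F (free_product_inr b) = free_lift t b by exact: free_product_lift_inr.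
exists F; split.
- apply/seteqP; split => // g _; rewrite -[g]pi1_classK.
  pose H g := range F g.
  apply: (@generation E cE El gam gamP H).
  + by exists 1%g => //; exact: morph_mulg_one.
  + by move=> _ _ [u _ <-] [v _ <-]; exists (u * v)%g => //; exact: F0M.
  + by move=> _ [u _ <-]; exists (u^-1)%g => //; exact: (morph_mulg_inv F0M).
  + move=> f; exists (free_product_inl (pi1_class f)) => //.
    by rewrite Finl /phi pi1_liftE.
  + move=> a; exists (z a), (free_product_inr (free_gen a)) => //.
    by rewrite Finr free_lift_gen /t ellE.
- have [m [cm mj]] := base_monodromy cEY EYl.
  move=> g g' gg'; have {gg'} : phi g = phi g' by rewrite -!Finl; exact: gg'.
  rewrite -[g]pi1_classK -[g']pi1_classK; move: (repr g) (repr g') => f f'.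
  rewrite /phi !pi1_liftE // => ff'.
  have jloop (k : {path I from y0 to y0}) : exists jk : {path I from j y0 to j y0},
      jk = j \o k :> (I -> B).
    apply: path_ends; rewrite /= ?path_zero ?path_one //.
    by apply: j_comp_continuous; exact: cts_fun.
  have [jf jfE] := jloop f; have [jf' jfE'] := jloop f'.
  move: ff'; rewrite -jfE -jfE' !El => /pi1_classP /(cocycle_homotopic cm).
  rewrite jfE jfE' !mj ?EYl; [|exact: cts_fun..].
  (* A loop of [Y] acts as right translation by its class, so the image of [1] recovers the
     class. *)
  by move=> /(congr1 (fun p => bij_fun p 1%g)) /=; rewrite !mul1g.
(* The counter of crossings: trivial on [Y], with value [free_gen a] at the wall [a]. It induces a
   left inverse of the map from the free group. *)
- have [|m [cm mj mc]] := extend_over_walls (cocycle_one R Y (free_group n))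
    (theta := fun a _ => free_gen a).
    by move=> a zeta _; rewrite mul1g mulg1.
  have Phi_t a : pi1_lift m (t a) = free_gen a.
    have [f fE] := ells a; rewrite /t -fE El pi1_liftE // fE ellE // !mj // mc.
    by rewrite invg1 mul1g mulg1.
  have liftM := pi1_liftM (x0 := j y0) cm.
  apply: (can_inj (g := pi1_lift m)) => b.
  have -> : (F \o free_product_inr) b = free_lift t b by exact: Finr.
  elim/pres_group_ind: b => [|b b' IHb IHb'|s|b IHb].
  + by rewrite (morph_mulg_one (@free_liftM _ _ t)) (morph_mulg_one liftM).
  + by rewrite free_liftM liftM IHb IHb'.
  + by rewrite -[pres_class _ _]/(free_gen s) free_lift_gen.
  + by rewrite (morph_mulg_inv (@free_liftM _ _ t)) (morph_mulg_inv liftM) IHb.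
Qed.

End Reachable.

End Walls.

(** * Configuration spaces *)

Section RealContinuity.
Context (S : topologicalType) (R : realType) (f g : S -> R) (s : S).
Hypotheses (cf : {for s, continuous f}) (cg : {for s, continuous g}).

Lemma add_continuous_at : {for s, continuous (fun x => f x + g x)}.
Proof. exact: (cvgD cf cg). Qed.

Lemma sub_continuous_at : {for s, continuous (fun x => f x - g x)}.
Proof. exact: (cvgB cf cg). Qed.

Lemma mul_continuous_at : {for s, continuous (fun x => f x * g x)}.
Proof. exact: (cvgM cf cg). Qed.

Lemma norm_continuous_at : {for s, continuous (fun x => `|f x|)}.
Proof. exact: (cvg_norm cf). Qed.

Lemma div_continuous_at : g s != 0 -> {for s, continuous (fun x => f x / g x)}.
Proof. by move=> g0; exact: (cvgM cf (cvgV g0 cg)). Qed.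

End RealContinuity.

Lemma big_continuous_at (S : topologicalType) (R : realType) (op : R -> R -> R)
    (idx : R) (J : Type) (r : seq J) (F : J -> S -> R) s :
  (forall f g : S -> R, {for s, continuous f} -> {for s, continuous g} ->
    {for s, continuous (fun x => op (f x) (g x))}) ->
  (forall i, {for s, continuous (F i)}) ->
  {for s, continuous (fun x => \big[op/idx]_(i <- r) F i x)}.
Proof.
move=> cop cF; elim: r => [|i r IHr].
  rewrite (_ : (fun x => _) = fun=> idx); first exact: cst_continuous.
  by apply/funext => x; rewrite big_nil.
rewrite (_ : (fun x => _) = fun x => op (F i x) (\big[op/idx]_(i <- r) F i x)).
  exact: cop.
by apply/funext => x; rewrite big_cons.
Qed.

(** Serves the inverse charts, which are defined by cases and coincide with coordinate functions
    only on an open set. *)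
Lemma continuous_at_near (S T : topologicalType) (f g : S -> T) s :
  (\forall s' \near s, f s' = g s') -> {for s, continuous f} ->
  {for s, continuous g}.
Proof.
move=> fg cf; move: cf; rewrite /prop_for /continuous_at (nbhs_singleton fg) => cf.
by apply: cvg_trans cf; exact: near_eq_cvg.
Qed.

Lemma filter_forall_finite (T : Type) (F : set_system T) (J : finType)
    (P : J -> T -> Prop) : Filter F -> (forall i, F (P i)) ->
  F (fun x => forall i, P i x).
Proof.
move=> FF FP.
have FS (s : seq J) : F (fun x => forall i, i \in s -> P i x).
  elim: s => [|i s IHs]; first by apply: filterE.
  apply: filterS2 (FP i) IHs => x Pi Ps k.
  by rewrite inE => /predU1P[->//|]; exact: Ps.
by apply: filterS (FS (enum J)) => x Px i; apply: Px; rewrite mem_enum.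
Qed.

Lemma initial_continuous_at (S T : topologicalType) (W : choiceType) (g : W -> T)
    (f : S -> initial_topology g) s :
  {for s, continuous (g \o f)} -> {for s, continuous f}.
Proof.
move=> cgf A [_ [[C Cop <-] Cfs sCA]].
apply: filterS sCA _; apply: (cgf C).
exact: open_nbhs_nbhs.
Qed.

Lemma ptws_continuous_at (S T : topologicalType) (U : Type)
    (f : S -> {ptws U -> T}) s :
  (forall u, {for s, continuous (fun x => f x u)}) -> {for s, continuous f}.
Proof.
move=> cf; apply/cvg_sup => u.
exact: (@initial_continuous_at S T _ (fun g => g u) f s (cf u)).
Qed.

Lemma ptws_eval_continuous (T : topologicalType) (U : choiceType) (u : U) :
  continuous (fun f : {ptws U -> T} => f u).
Proof. exact: (@proj_continuous U (fun=> T) u). Qed.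

Section ConfSpace.
Context (R : realType) (V : finType) (m : nat) (W : set {ptws V -> R}).
Local Notation T := {ptws V -> R}.

Definition bary (y : conf m W) (a : 'I_m) (w : V) : R := (set_val y : {ptws 'I_m -> T}) a w.

Definition mk_conf (y : {ptws 'I_m -> T}) (h : conf m W y) : conf m W :=
  exist (fun z => z \in conf m W) y (mem_set h).

Lemma bary_mk_conf y (h : conf m W y) : bary (mk_conf h) = y.
Proof. by rewrite /bary set_valE. Qed.

Lemma bary_conf (y : conf m W) : conf m W (bary y).
Proof. by rewrite /bary set_valE; case: y => y /= /set_mem. Qed.

Lemma bary_inj : injective bary.
Proof. by move=> y z; rewrite /bary set_valE => yz; apply: val_inj; exact: yz. Qed.

Lemma bary_continuous a w : continuous (fun y : conf m W => bary y a w).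
Proof.
move=> y.
apply: (@continuous_comp _ _ _ (fun y : conf m W => (set_val y : {ptws 'I_m -> T}) a)
  (fun p : T => p w)); last exact: ptws_eval_continuous.
apply: (@continuous_comp _ _ _ (fun y : conf m W => (set_val y : {ptws 'I_m -> T}))
  (fun p => p a)); last exact: ptws_eval_continuous.
exact: initial_continuous.
Qed.

Lemma conf_continuous_at (S : topologicalType) (f : S -> conf m W) s :
  (forall a w, {for s, continuous (fun x => bary (f x) a w)}) ->
  {for s, continuous f}.
Proof.
move=> cf; apply: (@initial_continuous_at _ _ _ set_val f s).
apply: ptws_continuous_at => a; apply: ptws_continuous_at => w; exact: cf.
Qed.

End ConfSpace.

Lemma reachable_sym (R : realType) (T : topologicalType) (a b : T) :
  reachable R a b -> reachable R b a.
Proof.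
move=> [s [cs s0 s1]]; exists (flip_path s).
by rewrite flip_path0 flip_path1; split => //; exact: flip_path_continuous.
Qed.

Lemma reachable_trans (R : realType) (T : topologicalType) (a b c : T) :
  reachable R a b -> reachable R b c -> reachable R a c.
Proof.
move=> [s [cs s0 s1]] [t [ct t0 t1]]; exists (join_path s t).
rewrite join_path0 join_path1; split => //.
by apply: join_path_continuous; rewrite ?s1.
Qed.

Lemma convex_same_sign (R : realType) (p q t : R) : 0 <= t -> t <= 1 ->
  p != 0 -> 0 < p * q -> (1 - t) * p + t * q != 0.
Proof.
move=> t0 t1 p0 pq; apply/eqP => E.
have h : p * ((1 - t) * p + t * q) = 0 by rewrite E mulr0.
have pp : 0 < p * p by rewrite -expr2 exprn_even_gt0.
have [tlt|tge] := ltP t 1; first by nra.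
have t1' : t = 1 by lra.
by move: h; rewrite t1'; nra.
Qed.

(** * From connected to path connected configuration spaces *)

Section ConfReachable.
Context (R : realType) (V : finType) (K : simplicial_complex V) (m : nat).
Context (x : {ptws V -> R}).
Local Notation T := {ptws V -> R}.
Local Notation W := (realization R K `\ x).
Local Notation I := (unit_interval R).

(* From every configuration in this neighbourhood of [y] the straight segment to
   [y] stays in the configuration space, although the realization is not locally
   convex: the simplices of [y'] contain those of [y]. *)
Definition star (y y' : {ptws 'I_m -> T}) : Prop :=
  [/\ forall a w, 0 < y a w -> 0 < y' a w,
      forall a b w, y a w != y b w -> 0 < (y a w - y b w) * (y' a w - y' b w) &
      forall a w, y a w != x w -> 0 < (y a w - x w) * (y' a w - x w)].

(** Finitely many conditions, each the positivity of a continuous function that is positive at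
    [y]. *)
Lemma near_star y : \forall y' \near y, star y y'.
Proof.
have ce a w : {for y, continuous (fun y' : {ptws 'I_m -> T} => y' a w)}.
  apply: (@continuous_comp _ _ _ (fun y' : {ptws 'I_m -> T} => y' a) (fun p : T => p w)).
    exact: ptws_eval_continuous.
  exact: ptws_eval_continuous.
have pos (f : {ptws 'I_m -> T} -> R) : {for y, continuous f} -> 0 < f y ->
    \forall y' \near y, 0 < f y'.
  by move=> cf f0; apply: (cf [set r | 0 < r]); exact: lt_nbhsr.
have c3 a b w : \forall y' \near y, y a w != y b w -> 0 < (y a w - y b w) * (y' a w - y' b w).
  have [->|ne] := eqVneq (y a w) (y b w); first by by apply: (@filterE _ (nbhs y)).
  apply: filterS (pos (fun y' => (y a w - y b w) * (y' a w - y' b w)) _ _) => //.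
    by apply: mul_continuous_at; [exact: cst_continuous|exact: sub_continuous_at].
  by rewrite -expr2 exprn_even_gt0 //= subr_eq0.
have c2 a w : \forall y' \near y, y a w != x w -> 0 < (y a w - x w) * (y' a w - x w).
  have [->|ne] := eqVneq (y a w) (x w); first by by apply: (@filterE _ (nbhs y)).
  apply: filterS (pos (fun y' => (y a w - x w) * (y' a w - x w)) _ _) => //.
    by apply: mul_continuous_at; [|apply: sub_continuous_at => //]; exact: cst_continuous.
  by rewrite -expr2 exprn_even_gt0 //= subr_eq0.
have c1 a w : \forall y' \near y, 0 < y a w -> 0 < y' a w.
  have [ya|ya] := ltP 0 (y a w); last by apply: (@filterE _ (nbhs y)).
  by apply: filterS (pos (fun y' => y' a w) (ce a w) ya).
have FF : Filter (nbhs y) := nbhs_filter y.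
have C1 := filter_forall_finite FF (fun a => filter_forall_finite FF (c1 a)).
have C2 := filter_forall_finite FF (fun a => filter_forall_finite FF (c2 a)).
have C3 := filter_forall_finite FF (fun a =>
  filter_forall_finite FF (fun b => filter_forall_finite FF (c3 a b))).
by apply: (@filterS3 _ (nbhs y) FF _ _ _ _ _ C1 C3 C2) => y' h1 h3 h2; split.
Qed.

Lemma star_segment y y' : conf m W y -> conf m W y' -> star y y' ->
  forall t, 0 <= t -> t <= 1 ->
  conf m W (fun a w => (1 - t) * y a w + t * y' a w).
Proof.
move=> [Wy dy] [Wy' dy'] [s1 s2 s3] t t0 t1; split.
  move=> a; have [[y0 y1 ys] yx] := Wy a; have [[y'0 y'1 y's] y'x] := Wy' a.
  split; first split.
  - move=> w; have := y0 w; have := y'0 w => ? ?.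
    by apply: addr_ge0; apply: mulr_ge0 => //; lra.
  - by rewrite big_split /= -!mulr_sumr y1 y'1; lra.
  (* A coordinate positive at [y] is positive at [y'], so the combination is supported in the
     simplex of [y' a]; its support is nonempty because the coordinates sum to [1]. *)
  - apply: (simplices_face y's).
      apply/fintype.subsetP => w; rewrite !inE; apply: contraNneq => yw.
      have yaw : y a w = 0.
        apply/eqP; rewrite eq_le y0 andbT leNgt; apply/negP => /s1.
        by rewrite yw ltxx.
      by rewrite yaw yw !mulr0 addr0.
    apply/eqP => s0.
    have := @ltr01 R; rewrite (_ : 1 = \sum_w ((1 - t) * y a w + t * y' a w)).
      rewrite big1 ?ltxx // => w _.
      by have := finset.in_set0 w; rewrite -s0 inE => /negbFE/eqP.
    by rewrite big_split /= -!mulr_sumr y1 y'1; lra.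
  - move=> xE; apply: yx; apply/funext => w; apply/eqP; apply/negPn/negP => yxw.
    have := convex_same_sign t0 t1 _ (s3 a w yxw); rewrite subr_eq0 => /(_ yxw)/negP; apply.
    by apply/eqP; have := congr1 (fun f : V -> R => f w) xE => /= <-; ring.
move=> a b ab E; apply: (dy a b ab); apply/funext => w; apply/eqP; apply/negPn/negP => yab.
have := convex_same_sign t0 t1 _ (s2 a b w yab); rewrite subr_eq0 => /(_ yab)/negP; apply.
have /= E' := congr1 (fun f : V -> R => f w) E.
rewrite (_ : _ + _ = ((1 - t) * y a w + t * y' a w) - ((1 - t) * y b w + t * y' b w)).
  by apply/eqP; rewrite E' subrr.
by ring.
Qed.

Lemma star_reachable y y' (h : conf m W y) (h' : conf m W y') : star y y' ->
  reachable R (mk_conf h) (mk_conf h').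
Proof.
move=> st; have seg := star_segment h h' st.
exists (fun t : I => mk_conf (seg (ival t) (ival_ge0 t) (ival_le1 t))); split.
- move=> t; apply: conf_continuous_at => a w.
  rewrite (_ : (fun _ => _) = fun t : I => (1 - ival t) * y a w + ival t * y' a w); last first.
    by apply/funext => s; rewrite bary_mk_conf.
  have ci := @ival_continuous R.
  apply: add_continuous_at; apply: mul_continuous_at;
    by [exact: cst_continuous|exact: ci|
        apply: sub_continuous_at; [exact: cst_continuous|exact: ci]].
- apply: bary_inj; rewrite !bary_mk_conf ival0.
  by apply/funext => a; apply/funext => w; rewrite subr0 mul1r mul0r addr0.
- apply: bary_inj; rewrite !bary_mk_conf ival1.
  by apply/funext => a; apply/funext => w; rewrite subrr mul1r mul0r add0r.
Qed.

(** Reachability from [y0] is constant on each [star]. Hence the reachable configurations [C] and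
    the others [D] are separated by the open sets [O C] and [O D], and [C] is open and closed in the
    configuration space. *)
Lemma conf_reachable : connected (conf m W) ->
  forall y z : conf m W, reachable R y z.
Proof.
move=> cW y0 z0.
pose C := [set y | exists h : conf m W y, reachable R y0 (mk_conf h)].
pose D := conf m W `\` C.
pose O (S : set {ptws 'I_m -> T}) := \bigcup_(y in S) (star y : set _)^°.
have O_open S : open (O S) by apply: bigcup_open => y _; exact: open_interior.
have starI y : (star y : set _)^° y by exact: near_star.
have CE : C = conf m W `&` O C.
  apply/seteqP; split=> [y [h yC]|y' [h' [y [h yC] yy']]].
    by split => //; exists y => //; exists h.
  exists h'; apply: reachable_trans yC _; apply: star_reachable.
  exact: interior_subset yy'.
have DE : C = conf m W `&` ~` O D.
  apply/seteqP; split=> [y' [h' y'C]|y [h nOD]].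
    split => // -[y [h nC] yy']; apply: nC; exists h.
    apply: reachable_trans y'C _; apply: reachable_sym; apply: star_reachable.
    exact: interior_subset yy'.
  by apply/not_notP => nC; apply: nOD; exists y.
have mkK (y : conf m W) (h : conf m W (bary y)) : mk_conf h = y.
  by apply: bary_inj; rewrite bary_mk_conf.
have Call : C = conf m W.
  apply: cW; last by exists (~` O D) => //; exact: open_closedC.
    exists (bary y0), (bary_conf y0); rewrite mkK.
    by exists (fun=> y0); split => //; exact: cst_continuous.
  by exists (O C).
have : C (bary z0) by rewrite Call; exact: bary_conf.
by move=> [h]; rewrite mkK.
Qed.

End ConfReachable.

Section MinOver.
Context (R : realType) (k : nat) (eps : R).

Definition min_over (F : 'I_k -> R) : R := \big[Num.min/eps]_i F i.

Lemma min_over_gt (F : 'I_k -> R) r : r < eps -> (forall i, r < F i) -> r < min_over F.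
Proof.
move=> re rF; apply: (big_ind (fun s => r < s)) => // a b ra rb.
by rewrite lt_min ra rb.
Qed.

Lemma min_over_le_eps (F : 'I_k -> R) : min_over F <= eps.
Proof. by apply: (big_rec (fun s => s <= eps)) => // i s _ se; rewrite ge_min se orbT. Qed.

Lemma min_over_le (F : 'I_k -> R) i : min_over F <= F i.
Proof.
rewrite /min_over; have : i \in index_enum 'I_k by rewrite mem_index_enum.
elim: index_enum => // l r IHr; rewrite inE big_cons ge_min => /predU1P[->|/IHr ->].
  by rewrite lexx.
by rewrite orbT.
Qed.

Lemma min_over_continuous_at (S : topologicalType) (F : 'I_k -> S -> R) s :
  (forall i, {for s, continuous (F i)}) ->
  {for s, continuous (fun x => min_over (F^~ x))}.
Proof.
move=> cF; apply: big_continuous_at => // f g cf cg.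
exact: (@continuous_min R S f g s cf cg).
Qed.

End MinOver.

(** * Configurations near a free edge *)

Section FreeEdge.
Context (R : realType) (V : finType) (K : simplicial_complex V).
Local Notation T := {ptws V -> R}.
Context (x : T) (u v : V) (uv : u != v).
Hypotheses (eK : finset.setU (finset.set1 u) (finset.set1 v) \in simplices K)
  (e_max : forall s, s \in simplices K ->
    finset.setU (finset.set1 u) (finset.set1 v) \subset s ->
    s = finset.setU (finset.set1 u) (finset.set1 v))
  (xK : realization R K x)
  (xe : Defs.support x = finset.setU (finset.set1 u) (finset.set1 v)).
Local Notation e := (finset.setU (finset.set1 u) (finset.set1 v)).
Local Notation X := (realization R K).

Definition edge_point (s : R) : T := fun w => x w + s * ((w == v)%:R - (w == u)%:R).
Definition edge_coord (p : T) : R := p v - x v.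
(* The factor is such that [edge_point s] is at distance [`|s|]. *)
Definition dist_x (p : T) : R := 2^-1 * \sum_w `|p w - x w|.
(** A coordinate differs from that of [x] by at most [2 * dist_x], so within this distance the
    coordinates at [u] and [v] stay positive. *)
Definition edge_eps : R := Num.min (x u) (x v) / 2.

Lemma x_out w : w != u -> w != v -> x w = 0.
Proof.
move=> wu wv; apply/eqP; have := congr1 (fun s : {set V} => w \in s) xe.
by rewrite !inE (negbTE wu) (negbTE wv) => /negbFE.
Qed.

Lemma x_pos w : w \in e -> 0 < x w.
Proof.
rewrite -xe inE => xw; have [x0 _ _] := xK.
by rewrite lt_neqAle eq_sym xw x0.
Qed.

Lemma xu_gt0 : 0 < x u. Proof. by apply: x_pos; rewrite !inE eqxx. Qed.
Lemma xv_gt0 : 0 < x v. Proof. by apply: x_pos; rewrite !inE eqxx orbT. Qed.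

Lemma edge_eps_gt0 : 0 < edge_eps.
Proof. by rewrite divr_gt0 // lt_min xu_gt0 xv_gt0. Qed.

Lemma edge_eps_lt : edge_eps < x u /\ edge_eps < x v.
Proof.
have := xu_gt0; have := xv_gt0 => v0 u0; rewrite /edge_eps.
by case: (leP (x u) (x v)) => ?; split; lra.
Qed.

Lemma sum_edge (F : V -> R) : (forall w, w != u -> w != v -> F w = 0) ->
  \sum_w F w = F u + F v.
Proof.
move=> F0; rewrite (bigD1 u) //= (bigD1 v) 1?eq_sym //=; congr (_ + _).
by rewrite big1 ?addr0 // => w /andP[wu wv]; exact: F0.
Qed.

Lemma x_sum : x u + x v = 1.
Proof. by have [_ <- _] := xK; rewrite sum_edge //; exact: x_out. Qed.

Lemma edge_point_u s : edge_point s u = x u - s.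
Proof. by rewrite /edge_point eqxx (negbTE uv) sub0r mulrN1. Qed.

Lemma edge_point_v s : edge_point s v = x v + s.
Proof. by rewrite /edge_point eqxx [v == u]eq_sym (negbTE uv) subr0 mulr1. Qed.

Lemma edge_point_out s w : w != u -> w != v -> edge_point s w = 0.
Proof.
by move=> wu wv; rewrite /edge_point (negbTE wu) (negbTE wv) x_out // subrr mulr0 addr0.
Qed.

Lemma edge_coordK s : edge_coord (edge_point s) = s.
Proof. by rewrite /edge_coord edge_point_v; ring. Qed.

Lemma dist_edge_point s : dist_x (edge_point s) = `|s|.
Proof.
rewrite /dist_x sum_edge => [|w wu wv]; last by rewrite edge_point_out // x_out // subrr normr0.
rewrite edge_point_u edge_point_v (_ : x u - s - x u = - s); last by ring.
by rewrite (_ : x v + s - x v = s) ?normrN; [lra|ring].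
Qed.

Lemma edge_point0 : edge_point 0 = x.
Proof. by apply/funext => w; rewrite /edge_point mul0r addr0. Qed.

Lemma dist_x_ge0 p : 0 <= dist_x p.
Proof. by rewrite mulr_ge0 ?invr_ge0 // sumr_ge0. Qed.

Lemma dist_x_gt0 p : (0 < dist_x p) <-> p <> x.
Proof.
split=> [h px|px]; first by move: h; rewrite px -edge_point0 dist_edge_point normr0 ltxx.
rewrite lt_neqAle dist_x_ge0 andbT; apply/eqP => /esym/eqP.
rewrite mulf_eq0 invr_eq0 pnatr_eq0 /= psumr_eq0 // => /allP p0; apply: px.
apply/funext => w; apply/eqP; rewrite -subr_eq0 -normr_eq0.
by apply: p0; rewrite mem_index_enum.
Qed.

Lemma edge_point_realization s : `|s| < edge_eps -> X (edge_point s).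
Proof.
have [eu ev] := edge_eps_lt => /ltr_normlP[s1 s2].
have pu : 0 < edge_point s u by rewrite edge_point_u; lra.
have pv : 0 < edge_point s v by rewrite edge_point_v; lra.
have cases w (P : R -> Prop) : P 0 -> P (edge_point s u) -> P (edge_point s v) ->
    P (edge_point s w).
  move=> P0 Pu Pv; have [->|wu] := eqVneq w u; first exact: Pu.
  by have [->|wv] := eqVneq w v; [exact: Pv|rewrite edge_point_out].
split.
- by move=> w; exact: (cases w (fun r => 0 <= r) (lexx 0) (ltW pu) (ltW pv)).
- rewrite sum_edge; last by move=> *; exact: edge_point_out.
  by rewrite edge_point_u edge_point_v; have := x_sum; lra.
- rewrite (_ : Defs.support _ = e) //; apply/setP => w; rewrite !inE.
  have [->|wu] := eqVneq w u; first by rewrite gt_eqF.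
  have [->|wv] := eqVneq w v; first by rewrite gt_eqF.
  by rewrite edge_point_out // eqxx.
Qed.

(** The maximality of the edge enters here: close to [x] the support contains both [u] and [v],
    hence is the edge, and as the coordinates sum to [1] a single one determines the point. *)
Lemma near_x_edge_point p : X p -> dist_x p < edge_eps ->
  p = edge_point (edge_coord p).
Proof.
move=> [p0 p1 ps] pe; have [_ _] := edge_eps_lt.
have coordle w : `|p w - x w| <= 2 * dist_x p.
  rewrite /dist_x mulVKf ?pnatr_eq0 // (bigD1 w) //= lerDl.
  by rewrite sumr_ge0.
have := xu_gt0; have := xv_gt0 => v0 u0.
have e1 : 2 * edge_eps <= x u.
  by rewrite /edge_eps mulrCA divff ?mulr1 ?ge_min ?lexx // pnatr_eq0.
have e2 : 2 * edge_eps <= x v.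
  by rewrite /edge_eps mulrCA divff ?mulr1 ?ge_min ?lexx ?orbT // pnatr_eq0.
have pu : 0 < p u by have := coordle u; rewrite ler_norml => /andP[? ?]; lra.
have pv : 0 < p v by have := coordle v; rewrite ler_norml => /andP[? ?]; lra.
have pE : Defs.support p = e.
  apply: e_max => //; apply/fintype.subsetP => w.
  by rewrite !inE => /orP[/eqP->|/eqP->]; rewrite gt_eqF.
have pout w : w != u -> w != v -> p w = 0.
  move=> wu wv; apply/eqP; have := congr1 (fun s : {set V} => w \in s) pE.
  by rewrite !inE (negbTE wu) (negbTE wv) => /negbFE.
apply/funext => w; have [->|wu] := eqVneq w u.
  rewrite edge_point_u /edge_coord; have := x_sum.
  by move: p1; rewrite sum_edge //; lra.
have [->|wv] := eqVneq w v; first by rewrite edge_point_v /edge_coord; ring.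
by rewrite edge_point_out // pout.
Qed.

Lemma dist_x_continuous_at (S : topologicalType) (f : S -> T) s :
  (forall w, {for s, continuous (fun y => f y w)}) ->
  {for s, continuous (fun y => dist_x (f y))}.
Proof.
move=> cf; apply: mul_continuous_at; first exact: cst_continuous.
apply: big_continuous_at => [g h cg ch|w]; first exact: add_continuous_at.
by apply: norm_continuous_at; apply: sub_continuous_at => //; exact: cst_continuous.
Qed.

(** * The handles of the configuration space *)

Section Instance.
Context (n : nat).
Local Notation Y := (conf n (X `\ x)).
Local Notation B := (conf n X).
Local Notation Z := (conf n.-1 (X `\ x)).
Context (y0 : Y).
Local Notation j := (@conf_incl T n _ X (@subDsetl _ X [set x])).

Definition omit (a : 'I_n) (y : 'I_n -> T) : 'I_n.-1 -> T := fun i => y (lift a i).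
Definition insert (a : 'I_n) (p : T) (z : 'I_n.-1 -> T) : 'I_n -> T :=
  fun c => if unlift a c is Some i then z i else p.
(** A further point within this distance of [x] lies on the edge, by the cap [edge_eps], and is
    strictly closer to [x] than all points of [z]. *)
Definition room (z : 'I_n.-1 -> T) : R := min_over edge_eps (fun i => dist_x (z i)).

Lemma omit_insert a p z : omit a (insert a p z) = z.
Proof. by apply/funext => i; rewrite /omit /insert liftK. Qed.

Lemma insert_at a p z : insert a p z a = p.
Proof. by rewrite /insert unlift_none. Qed.

Lemma insert_omit a y : insert a (y a) (omit a y) = y.
Proof. by apply/funext => c; rewrite /insert /omit; case: unliftP => [i ->|->]. Qed.

Lemma room_gt0 z : conf n.-1 (X `\ x) z -> 0 < room z.
Proof.
move=> [zX _]; apply: min_over_gt; first exact: edge_eps_gt0.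
by move=> i; apply/dist_x_gt0; have [] := zX i.
Qed.

(* Reparametrizes the interval of radius [room z] by the real line. *)
Definition offset (z : 'I_n.-1 -> T) (r : R) : R := room z * r / (1 + `|r|).

Lemma offset_lt z r : 0 < room z -> `|offset z r| < room z.
Proof.
move=> z0; have r0 := normr_ge0 r.
rewrite /offset normrM normfV normrM (gtr0_norm z0) [`|1 + _|]gtr0_norm; last by lra.
by rewrite ltr_pdivrMr; nra.
Qed.

Lemma offset_eq0 z r : 0 < room z -> (offset z r == 0) = (r == 0).
Proof.
move=> z0; have r0 := normr_ge0 r.
rewrite /offset !mulf_eq0 invr_eq0 gt_eqF //= (gt_eqF (x := 1 + _)) ?orbF //; lra.
Qed.

Lemma offsetK z r : 0 < room z ->
  offset z r / (room z - `|offset z r|) = r.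
Proof.
move=> z0; have r0 := normr_ge0 r.
have E : room z - `|offset z r| = room z / (1 + `|r|).
  rewrite /offset normrM normfV normrM (gtr0_norm z0) [`|1 + _|]gtr0_norm; last by lra.
  by field; lra.
by rewrite E /offset; field; rewrite gt_eqF //=; lra.
Qed.

Lemma offset_inv z s : `|s| < room z -> offset z (s / (room z - `|s|)) = s.
Proof.
move=> sz; have s0 := normr_ge0 s; have d0 : 0 < room z - `|s| by lra.
rewrite /offset normrM normfV (gtr0_norm d0); field.
by apply/andP; split; rewrite gt_eqF //; lra.
Qed.

Lemma insert_conf a z s : conf n.-1 (X `\ x) z -> `|s| < room z ->
  conf n X (insert a (edge_point s) z).
Proof.
move=> [zX zinj] sz.
have se : `|s| < edge_eps by apply: lt_le_trans sz (min_over_le_eps _ _).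
have pz i : edge_point s <> z i.
  move=> E; have : room z <= dist_x (z i) by exact: min_over_le.
  by rewrite -E dist_edge_point leNgt sz.
split=> [c|c d cd]; rewrite /insert; case: unliftP => [i ci|ca].
- by have [] := zX i.
- exact: edge_point_realization.
- case: unliftP => [k dk|da]; last by move=> /esym; exact: pz.
  by apply: zinj => ik; apply: cd; rewrite ci dk ik.
- case: unliftP => [k dk|da]; first exact: pz.
  by case: cd; rewrite ca da.
Qed.

Lemma insert_off a z s : conf n.-1 (X `\ x) z -> `|s| < room z -> s != 0 ->
  conf n (X `\ x) (insert a (edge_point s) z).
Proof.
move=> zc sz s0; have [iX iinj] := insert_conf a zc sz; split => // c.
split; first exact: iX.
rewrite /insert; case: unliftP => [i ci|ca]; first by have [zX _] := zc; have [] := zX i.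
by apply/dist_x_gt0; rewrite dist_edge_point normr_gt0.
Qed.

Lemma omit_conf (W : set T) a y : conf n W y -> conf n.-1 W (omit a y).
Proof.
move=> [yW yinj]; split=> [i|i k ik]; first exact: yW.
by apply: yinj => /lift_inj.
Qed.

Definition forget (a : 'I_n) (y : Y) : Z := mk_conf (omit_conf a (bary_conf y)).

Definition wall_chart (a : 'I_n) (zr : Z * R) : B :=
  mk_conf (insert_conf a (bary_conf zr.1) (offset_lt zr.2 (room_gt0 (bary_conf zr.1)))).

Definition unincl (b : B) : Y :=
  match pselect (conf n (X `\ x) (bary b)) with
  | left h => mk_conf h
  | right _ => y0
  end.

Definition chart_conf (a : 'I_n) (b : B) : Z :=
  match pselect (conf n.-1 (X `\ x) (omit a (bary b))) with
  | left h => mk_conf h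
  | right _ => forget a y0
  end.

(** The inverse of [offset]: solving [s = room * r / (1 + |r|)] for [r] gives [s / (room - |s|)]. *)
Definition chart_coord (a : 'I_n) (b : B) : R :=
  edge_coord (bary b a) / (room (omit a (bary b)) - `|edge_coord (bary b a)|).

Lemma bary_wall_chart a z r :
  bary (wall_chart a (z, r)) = insert a (edge_point (offset (bary z) r)) (bary z).
Proof. exact: bary_mk_conf. Qed.

Lemma bary_incl (y : Y) : bary (j y) = bary y.
Proof. by rewrite /bary [in LHS]set_valE. Qed.

Lemma bary_unincl b : conf n (X `\ x) (bary b) -> bary (unincl b) = bary b.
Proof. by rewrite /unincl; case: pselect => // h _; rewrite bary_mk_conf. Qed.

Lemma bary_chart_conf a b : conf n.-1 (X `\ x) (omit a (bary b)) ->
  bary (chart_conf a b) = omit a (bary b).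
Proof. by rewrite /chart_conf; case: pselect => // h _; rewrite bary_mk_conf. Qed.

Lemma range_incl b : range j b <-> forall a, bary b a <> x.
Proof.
split=> [[y _ <-] a|bx].
  by rewrite bary_incl; have [yX _] := bary_conf y; have [] := yX a.
have [bX binj] := bary_conf b.
have h : conf n (X `\ x) (bary b) by split => // a; split; [exact: bX|exact: bx].
by exists (mk_conf h) => //; apply: bary_inj; rewrite bary_incl bary_mk_conf.
Qed.

Lemma near_wall a (b : B) : dist_x (bary b a) < room (omit a (bary b)) ->
  conf n.-1 (X `\ x) (omit a (bary b)) /\
  bary b a = edge_point (edge_coord (bary b a)) /\
  `|edge_coord (bary b a)| < room (omit a (bary b)).
Proof.
move=> ba; have [bX binj] := bary_conf b.
have bE : bary b a = edge_point (edge_coord (bary b a)).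
  by apply: near_x_edge_point => //; apply: lt_le_trans ba (min_over_le_eps _ _).
split; last by split => //; rewrite -dist_edge_point -bE.
have [oX oinj] := omit_conf a (bary_conf b); split => // i; split; first exact: oX.
apply/dist_x_gt0; apply: le_lt_trans (dist_x_ge0 _) _; apply: lt_le_trans ba _.
exact: (min_over_le edge_eps (fun i => dist_x (omit a (bary b) i))).
Qed.

Lemma range_wall_chart a b :
  range (wall_chart a) b <-> dist_x (bary b a) < room (omit a (bary b)).
Proof.
split=> [[[z r] _ <-]|ba].
  rewrite bary_wall_chart omit_insert insert_at dist_edge_point.
  exact/offset_lt/room_gt0/bary_conf.
have [h [bE bs]] := near_wall ba.
exists (mk_conf h, chart_coord a b) => //; apply: bary_inj.
by rewrite bary_wall_chart bary_mk_conf /chart_coord offset_inv // -bE insert_omit.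
Qed.

Lemma bary_at_continuous (W : set T) m (y : conf m W) a w :
  {for y, continuous (fun y : conf m W => bary y a w)}.
Proof. exact: bary_continuous. Qed.

Lemma room_continuous_at (S : topologicalType) (f : S -> 'I_n.-1 -> T) s :
  (forall i w, {for s, continuous (fun y => f y i w)}) ->
  {for s, continuous (fun y => room (f y))}.
Proof.
move=> cf; apply: (@min_over_continuous_at _ _ _ S (fun i y => dist_x (f y i))) => i.
by apply: dist_x_continuous_at => w.
Qed.

Lemma open_wall a : open (range (wall_chart a)).
Proof.
rewrite (_ : range _ = [set b | 0 < room (omit a (bary b)) - dist_x (bary b a)]); last first.
  by apply/seteqP; split=> b /=; rewrite subr_gt0 => /range_wall_chart.
pose f (b : B) : R := room (omit a (bary b)) - dist_x (bary b a).
have c : continuous f.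
  move=> b; refine (@sub_continuous_at B R (fun b : B => room (omit a (bary b)))
    (fun b : B => dist_x (bary b a)) b _ _).
    by apply: room_continuous_at => i w; exact: bary_continuous.
  by apply: dist_x_continuous_at => w; exact: bary_continuous.
by have := (continuousP _).1 c [set r : R | 0 < r]; apply; exact: open_gt.
Qed.

Lemma open_range_incl : open (range j).
Proof.
rewrite openE => b /range_incl bx; rewrite /interior.
have : \forall b' \near b, forall a, 0 < dist_x (bary b' a).
  apply: filter_forall_finite => a.
  have c : {for b, continuous (fun b' : B => dist_x (bary b' a))}.
    by apply: dist_x_continuous_at => w; exact: bary_at_continuous.
  by apply: (c [set r | 0 < r]); apply: lt_nbhsr; apply/dist_x_gt0.
by apply: filterS => b' b'x; apply/range_incl => a; apply/dist_x_gt0.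
Qed.

Lemma conf_walls : walls j unincl wall_chart chart_conf chart_coord forget.
Proof.
have jconf b : range j b -> conf n (X `\ x) (bary b).
  by move=> [y _ <-]; rewrite bary_incl; exact: bary_conf.
have roomP (z : Z) : 0 < room (bary z) by exact/room_gt0/bary_conf.
split.
- move=> y; apply: conf_continuous_at => a w.
  rewrite (_ : (fun _ => _) = fun y : Y => bary y a w); first exact: bary_continuous.
  by apply/funext => y'; rewrite bary_incl.
- by move=> y; apply: bary_inj; rewrite bary_unincl bary_incl //; exact: bary_conf.
- move=> b jb; apply: conf_continuous_at => a w.
  apply: (@continuous_at_near _ _ (fun b : B => bary b a w)); last exact: bary_continuous.
  have : \forall b' \near b, range j b'.
    by apply: open_nbhs_nbhs; split => //; exact: open_range_incl.
  by apply: filterS => b' /jconf h; rewrite bary_unincl.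
- exact: open_range_incl.
- move=> a zr; apply: conf_continuous_at => c w.
  have cz i w' : {for zr, continuous (fun zr : Z * R => bary zr.1 i w')}.
    apply: (@continuous_comp _ _ _ fst (fun z : Z => bary z i w')); first exact: cvg_fst.
    exact: bary_continuous.
  have croom : {for zr, continuous (fun zr : Z * R => room (bary zr.1))}.
    exact: room_continuous_at.
  have c2 : {for zr, continuous (fun zr : Z * R => zr.2)} by exact: cvg_snd.
  rewrite (_ : (fun _ => _) = fun zr : Z * R =>
    insert a (edge_point (offset (bary zr.1) zr.2)) (bary zr.1) c w); last first.
    by apply/funext => -[z r]; rewrite bary_wall_chart.
  rewrite /insert; case: unliftP => [i _|_]; first exact: cz.
  apply: add_continuous_at; first exact: cst_continuous.
  apply: mul_continuous_at; last exact: cst_continuous.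
  apply: div_continuous_at; first exact: mul_continuous_at.
    by apply: add_continuous_at; [exact: cst_continuous|exact: norm_continuous_at].
  by have := normr_ge0 zr.2 => ?; rewrite gt_eqF //; lra.
- move=> a z r; apply: bary_inj.
  by rewrite bary_chart_conf bary_wall_chart omit_insert //; exact: bary_conf.
- move=> a z r; rewrite /chart_coord bary_wall_chart omit_insert insert_at edge_coordK.
  exact: offsetK.
- move=> a b Wb; apply: conf_continuous_at => i w.
  apply: (@continuous_at_near _ _ (fun b : B => bary b (lift a i) w)); last exact: bary_continuous.
  have : \forall b' \near b, range (wall_chart a) b'.
    by apply: open_nbhs_nbhs; split => //; exact: open_wall.
  apply: filterS => b' /range_wall_chart /near_wall[h _].
  by rewrite bary_chart_conf.
- move=> a b /range_wall_chart Wb; have [_ [_ bs]] := near_wall Wb.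
  have ce : {for b, continuous (fun b : B => edge_coord (bary b a))}.
    by apply: sub_continuous_at; [exact: bary_continuous|exact: cst_continuous].
  apply: div_continuous_at => //; last by rewrite gt_eqF // subr_gt0.
  apply: sub_continuous_at; last exact: norm_continuous_at.
  by apply: room_continuous_at => i w; exact: bary_continuous.
- exact: open_wall.
- move=> a z r; rewrite -(offset_eq0 r (roomP z)); split=> [/range_incl|s0].
    move=> /(_ a); rewrite bary_wall_chart insert_at => px; apply/negP => /eqP s0.
    by apply: px; rewrite s0 edge_point0.
  apply/range_incl => c; rewrite bary_wall_chart.
  have [iX _] := insert_off a (bary_conf z) (offset_lt r (roomP z)) s0.
  by have [] := iX c.
- move=> a a' b /range_wall_chart Wa /range_wall_chart Wa'.
  apply/eqP/negPn/negP => aa'.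
  (* A point within its [room] is strictly the closest to [x], which can hold for one index only. *)
  have key c d : c != d -> dist_x (bary b c) < room (omit c (bary b)) ->
      dist_x (bary b c) < dist_x (bary b d).
    move=> cd h; apply: lt_le_trans h _.
    have [i ->] := unlift_some cd.
    by move=> _; exact: (min_over_le edge_eps (fun i => dist_x (omit c (bary b) i))).
  have := lt_trans (key _ _ aa' Wa) (key a' a _ Wa').
  by rewrite ltxx eq_sym => /(_ aa').
- move=> b; have [jb|njb] := pselect (range j b); first by left.
  right; have [a ba] : exists a, bary b a = x.
    by apply: contrapT => nb; apply: njb; apply/range_incl => a ba; apply: nb; exists a.
  exists a; apply/range_wall_chart.
  rewrite ba -edge_point0 dist_edge_point normr0.
  apply: min_over_gt; first exact: edge_eps_gt0.
  move=> i; apply/dist_x_gt0; rewrite -ba /omit.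
  have [_ binj] := bary_conf b; apply: binj => E.
  by have := neq_lift a i; rewrite -{1}E eqxx.
- move=> a y; apply: conf_continuous_at => i w.
  rewrite (_ : (fun _ => _) = fun y : Y => bary y (lift a i) w); first exact: bary_continuous.
  by apply/funext => y'; rewrite bary_mk_conf.
- move=> a y z r jy; apply: bary_inj; rewrite bary_mk_conf -bary_incl jy.
  by rewrite bary_wall_chart omit_insert.
Qed.

End Instance.
End FreeEdge.

Theorem corollary3p6 (R : realType) (V : finType) (K : simplicial_complex V)
  (n : nat) (e : {set V}) (x : {ptws V -> R})
  (x0 : conf n (realization R K `\ x)) :
  connected (realization R K) ->
  (1 <= complex_dim K)%N ->
  (2 <= n)%N ->
  free_edge R K e ->
  open_cell R K e x ->
  connected (conf n (realization R K `\ x)) ->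
  connected (conf n.-1 (realization R K `\ x)) ->
  exists f : {multiplicative
      free_product (pure_braid_group R x0) (free_group n) ->
      pure_braid_group R (conf_incl (@subDsetl _ (realization R K) [set x]) x0)},
    [/\ range f = [set: _],
        injective (f \o free_product_inl) &
        injective (f \o free_product_inr)].
Proof.
move=> _ _ _ [eK /eqP/cards2P[u [v [uv eE]]] e_max _] [xK xe] cY cZ.
rewrite eE in eK e_max xe.
have wP := conf_walls uv eK e_max xK xe x0.
exact: (pi1_walls wP x0 (conf_reachable cY) (conf_reachable cZ)).
Qed.
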